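(* Let $\mathcal{A}\to\mathcal{M}$ be an algebroid, and equip $[-1]T\mathcal{A}\to[-1]T\mathcal{M}$ with the anchor $\widetilde\rho$ and bracket determined on complete and vertical lifts of sections $X,Y\in\Gamma(\mathcal{A})$ by $$\widetilde\rho(X^C)=\mathcal{L}_{\rho(X)},\quad \widetilde\rho(X^V)=\iota_{\rho(X)},$$ $$[X^C,Y^C]=[X,Y]^C,\quad [X^C,Y^V]=[X,Y]^V,\quad [X^V,Y^V]=0,$$ extended respectively by $C^\infty([-1]T\mathcal{M})$-linearity and by the Leibniz rule. Let $d_{[-1]T\mathcal{A}}$ be the associated vector field on $[-1]_{[-1]T\mathcal{M}}([-1]T\mathcal{A})$. Then, under the identification $[-1]_{[-1]T\mathcal{M}}([-1]T\mathcal{A})=[-1]_{[-1]\mathcal{A}}T([-1]\mathcal{A})$, $$d_{[-1]T\mathcal{A}}=\mathcal{L}_{d_{\mathcal{A}}},$$ the Lie derivative with respect to the vector field $d_{\mathcal{A}}\in\mathfrak{X}([-1]\mathcal{A})$.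
   Context: Supermanifolds are $\mathbb{Z}$-graded; $|\cdot|$ is degree. $[-1]\mathcal{E}$ denotes the shift of a vector bundle raising the degree of the fibre coordinates by $1$; a subscript (as in $[-1]_{\mathcal{B}}$) indicates the base of the vector bundle structure used for the shift. $\Gamma(\mathcal{E})$ is the graded module of sections, local frames $\{X_a\}$ dual to fibre coordinates $\{\xi^a\}$ having $|X_a|=-|\xi^a|$. An algebroid $\mathcal{A}\to\mathcal{M}$ is a vector bundle with degree $0$ anchor $\rho:\Gamma(\mathcal{A})\to\mathfrak{X}(\mathcal{M})$ and Lie superbracket on $\Gamma(\mathcal{A})$ with $[X,fY]=\rho(X)(f)Y+(-1)^{|X||f|}f[X,Y]$. To an anchor and a graded skew bracket satisfying the Leibniz rule one associates the degree $1$ vector field on $[-1]\mathcal{A}$ $$d_{\mathcal{A}}=\lambda^\alpha\rho_\alpha^i\frac{\partial}{\partial x^i}-(-1)^{p_\alpha(p_\beta-1)}\tfrac12\lambda^\alpha\lambda^\beta c_{\alpha\beta}^\gamma\frac{\partial}{\partial\lambda^\gamma},$$ where $\{X_\alpha\}$ is a local frame, $p_\alpha=|X_\alpha|$, $\rho(X_\alpha)=\rho_\alpha^i\partial_{x^i}$, $[X_\alpha,X_\beta]=c_{\alpha\beta}^\gamma X_\gamma$, and $\lambda^\alpha$ are the dual shifted fibre coordinates, $|\lambda^\alpha|=1-p_\alpha$. The vector field $d_{[-1]T\mathcal{A}}$ is obtained from the same recipe applied to the bundle $[-1]T\mathcal{A}\to[-1]T\mathcal{M}$. For a supermanifold $\mathcal{N}$,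 $[-1]T\mathcal{N}$ is the odd tangent bundle, with coordinates $x^i,\dot x^i=dx^i$, $|\dot x^i|=|x^i|+1$, and de Rham vector field $d=\dot x^i\partial/\partial x^i$. For $X\in\mathfrak{X}(\mathcal{N})$, $\iota_X$ is the degree $|X|-1$ vector field on $[-1]T\mathcal{N}$ with $\iota_Xf=0$, $\iota_X(df)=X(f)$ for $f\in C^\infty(\mathcal{N})$, and $\mathcal{L}_X=[\iota_X,d]$. $[-1]T\mathcal{A}$ means the shift of the tangent bundle $T\mathcal{A}$ over $\mathcal{A}$; it is also a vector bundle over $[-1]T\mathcal{M}$, with fibre coordinates $(\lambda^\alpha,\dot\lambda^\alpha)$ where $\lambda^\alpha$ are linear fibre coordinates on $\mathcal{A}$ and $\dot\lambda^\alpha=d\lambda^\alpha$. Shifting these fibre coordinates up by one identifies $[-1]_{[-1]T\mathcal{M}}([-1]T\mathcal{A})$ with $[-1]T([-1]\mathcal{A})$ (coordinates $x,\lambda,\dot x,\dot\lambda$). For $X\in\Gamma(\mathcal{A})$ the complete lift $X^C$ (degree $|X|$) and the vertical lift $X^V$ (degree $|X|-1$) are sections of $[-1]T\mathcal{A}\to[-1]T\mathcal{M}$ depending linearly on $X$, characterized as follows: if $\{X_\alpha\}$ is the local frame of $\mathcal{A}$ dual to $\{\lambda^\alpha\}$, then $\{X_\alpha^C,-X_\alpha^V\}$ is the frame of $[-1]T\mathcal{A}\to[-1]T\mathcal{M}$ dual to $\{\lambda^\alpha,\dot\lambda^\alpha\}$; and for $f\in C^\infty(\mathcal{M})$, $(fX)^C=f\,X^C+(-1)^{|X|+|f|}df\,X^V$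 and $(fX)^V=f\,X^V$. These lifts span $\Gamma([-1]T\mathcal{A})$ over $C^\infty([-1]T\mathcal{M})$. *)

(* Defs.v *)
From mathcomp Require Import all_boot all_order all_algebra.
From mathcomp Require Import all_classical all_reals all_analysis.

Set Implicit Arguments.
Unset Strict Implicit.
Unset Printing Implicit Defensive.

Import GRing.Theory Num.Theory.
Import numFieldNormedType.Exports.

Local Open Scope classical_set_scope.
Local Open Scope ring_scope.

Definition ksign (A : pzRingType) (k : int) : A := (-1) ^+ `|k|%N.
Arguments ksign {A} k.

Definition open_in (T : topologicalType) (V U : set T) : Prop :=
  open U /\ U `<=` V.

Definition sum_fam (T A B : Type) (f : A -> T) (g : B -> T) (s : A + B) : T :=
  match s with inl a => f a | inr b => g b end.

(** * Smooth functions of the degree 0 coordinates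

    A point of a superdomain with coordinates [x i] of degree [deg i] is stored
    as a full tuple [y : I -> R] whose entries of nonzero degree vanish, so that
    [body_space deg] is R^n with n the number of degree 0 coordinates. *)

Section Smooth.
Variables (R : realType) (I : finType).
Implicit Types (deg : I -> int) (U : set {ptws I -> R}) (f : (I -> R) -> R).

Definition body_space deg : set {ptws I -> R} :=
  [set y | forall i, deg i != 0 -> y i = 0].

Definition open_body deg U : Prop :=
  exists2 G : set {ptws I -> R}, open G & U = G `&` body_space deg.

Definition slice f (y : I -> R) (i : I) : R -> R :=
  fun t => f (fun j => if j == i then t else y j).

Definition pderiv (i : I) f : (I -> R) -> R := fun y => derive1 (slice f y i) (y i).

Definition pderivs (s : seq I) f : (I -> R) -> R := foldr pderiv f s.

Definition smooth deg U f : Prop :=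
  forall s : seq I, all (fun i => deg i == 0) s ->
    {within U, continuous (pderivs s f : {ptws I -> R} -> R)} /\
    forall y i, U y -> deg i = 0 ->
      derivable (slice (pderivs s f) y i : R -> R) (y i) 1.

End Smooth.

(** * Sheaves of Z-graded abelian groups

    Sections are the finite sums of homogeneous ones, hence gluing is required
    in each degree separately. *)

Record graded_sheaf (T : topologicalType) (S : set T -> zmodType)
    (res : forall U V, S U -> S V) (hom : forall U, int -> S U -> Prop) : Prop := {
  sh_resB : forall U V s t, open U -> open_in U V ->
    res U V (s - t) = res U V s - res U V t;
  sh_res_id : forall U s, open U -> res U U s = s;
  sh_res_comp : forall U V W s, open U -> open_in U V -> open_in V W ->
    res V W (res U V s) = res U W s;
  sh_hom0 : forall U k, open U -> hom U k 0;
  sh_homB : forall U k s t, open U -> hom U k s -> hom U k t -> hom U k (s - t);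
  sh_hom_res : forall U V k s, open U -> open_in U V ->
    hom U k s -> hom V k (res U V s);
  sh_decomp : forall U s, open U -> exists (ks : seq int) (c : int -> S U),
    (forall k, hom U k (c k)) /\ s = \sum_(k <- ks) c k;
  sh_indep : forall U (ks : seq int) (c : int -> S U), open U -> uniq ks ->
    (forall k, hom U k (c k)) -> \sum_(k <- ks) c k = 0 ->
    forall k, k \in ks -> c k = 0;
  sh_separated : forall U s, open U ->
    (forall p, U p -> exists W, [/\ open_in U W, W p & res U W s = 0]) -> s = 0;
  sh_glue : forall (J : Type) (C : J -> set T) k (s : forall j, S (C j)),
    (forall j, open (C j)) -> (forall j, hom (C j) k (s j)) ->
    (forall i j, res (C i) (C i `&` C j) (s i) = res (C j) (C i `&` C j) (s j)) ->
    exists2 t : S (\bigcup_j C j), hom (\bigcup_j C j) k t &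
      forall j, res (\bigcup_j C j) (C j) t = s j }.

(** * Z-graded supermanifolds *)

Record graded_space (R : realType) := GradedSpace {
  body :> topologicalType;
  fn : set body -> pzRingType;
  cst : forall U, {rmorphism R -> fn U};
  res : forall U V, fn U -> fn V;
  hdeg : forall U, int -> fn U -> Prop }.

Arguments fn {R} X U : rename.
Arguments cst {R X} U : rename.
Arguments res {R X} U V f : rename.
Arguments hdeg {R X U} k f : rename.

Record graded_space_axioms (R : realType) (X : graded_space R) : Prop := {
  gs_sheaf : graded_sheaf (S := fun U => fn X U : zmodType) (@res R X) (@hdeg R X);
  gs_res1 : forall U V, open U -> open_in U V -> res U V (1 : fn X U) = 1;
  gs_resM : forall U V (f g : fn X U), open U -> open_in U V ->
    res U V (f * g) = res U V f * res U V g;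
  gs_res_cst : forall U V c, open U -> open_in U V ->
    res U V (cst U c : fn X U) = cst V c;
  gs_hdeg_cst : forall U c, open U -> hdeg 0 (cst U c : fn X U);
  gs_hdegM : forall U k l (f g : fn X U), open U ->
    hdeg k f -> hdeg l g -> hdeg (k + l) (f * g);
  gs_comm : forall U k l (f g : fn X U), open U ->
    hdeg k f -> hdeg l g -> f * g = ksign (k * l) * (g * f) }.

Section Charts.
Variables (R : realType) (X : graded_space R).

Definition mono (V U : set X) (I : finType) (x : I -> fn X V)
    (e : {ffun I -> nat}) : fn X U :=
  \prod_(i : I) res V U (x i) ^+ e i.

(** Exponents of the monomials forming a basis of S(V), V spanned by the
    coordinates of nonzero degree. *)
Definition expo (I : finType) (deg : I -> int) (e : {ffun I -> nat}) : bool :=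
  [forall i, ((deg i == 0) ==> (e i == 0%N)) &&
             (odd `|deg i|%N ==> (e i <= 1)%N)].

(** An isomorphism, over the homeomorphism [kap], of [X] restricted to [V] with
    the sheaf generated by U |-> C^oo(U) (x) S(V): [ev U f] is the function
    f(x^1, ..., x^n), and every section is locally, and uniquely, a polynomial
    in the coordinates of nonzero degree with such coefficients. *)
Record chart_on (V : set X) (I : finType) (deg : I -> int) (x : I -> fn X V)
    (kap : X -> (I -> R)) (ev : forall U : set X, ((I -> R) -> R) -> fn X U)
    : Prop := {
  ch_open : open V;
  ch_deg : forall i, hdeg (deg i) (x i);
  ch_cont : {within V, continuous (kap : X -> {ptws I -> R})};
  ch_inj : {in V &, injective kap};
  ch_img : forall U, open_in V U -> open_body deg (kap @` U);
  ch_ev_ext : forall U f g, open_in V U ->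
    {in kap @` U, f =1 g} -> ev U f = ev U g;
  ch_ev_deg : forall U f, open_in V U -> smooth deg (kap @` U) f ->
    hdeg 0 (ev U f);
  ch_evD : forall U f g, open_in V U ->
    smooth deg (kap @` U) f -> smooth deg (kap @` U) g ->
    ev U (fun y => f y + g y) = ev U f + ev U g;
  ch_evM : forall U f g, open_in V U ->
    smooth deg (kap @` U) f -> smooth deg (kap @` U) g ->
    ev U (fun y => f y * g y) = ev U f * ev U g;
  ch_ev_cst : forall U c, open_in V U -> ev U (fun=> c) = cst U c;
  ch_ev_coord : forall U i, open_in V U -> deg i = 0 ->
    ev U (fun y => y i) = res V U (x i);
  ch_ev_res : forall U W f, open_in V U -> open_in U W ->
    smooth deg (kap @` U) f -> res U W (ev U f) = ev W f;
  ch_span : forall U (F : fn X U) p, open_in V U -> U p ->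
    exists W (es : seq {ffun I -> nat}) (f : {ffun I -> nat} -> (I -> R) -> R),
      [/\ open_in U W, W p, all (expo deg) es,
          forall e, smooth deg (kap @` W) (f e) &
          res U W F = \sum_(e <- es) ev W (f e) * mono W x e];
  ch_free : forall U (es : seq {ffun I -> nat})
      (f : {ffun I -> nat} -> (I -> R) -> R),
    open_in V U -> uniq es -> all (expo deg) es ->
    (forall e, smooth deg (kap @` U) (f e)) ->
    \sum_(e <- es) ev U (f e) * mono U x e = 0 ->
    forall e, e \in es -> {in kap @` U, f e =1 fun=> 0} }.

Definition chart (V : set X) (I : finType) (deg : I -> int) (x : I -> fn X V) :=
  exists kap ev, chart_on deg x kap ev.

End Charts.

Record supermanifold (R : realType) := Supermanifold {
  space :> graded_space R;
  sm_axioms : graded_space_axioms space;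
  sm_hausdorff : hausdorff_space space;
  sm_countable : @second_countable space;
  sm_charts : forall p : space, exists (V : set space) (I : finType)
    (deg : I -> int) (x : I -> fn space V), V p /\ chart deg x }.

Record smap (R : realType) (N M : supermanifold R) := SMap {
  bmap :> N -> M;
  pull : forall U : set M, fn M U -> fn N (bmap @^-1` U);
  sm_cont : continuous bmap;
  pullB : forall U (f g : fn M U), open U -> pull (f - g) = pull f - pull g;
  pullM : forall U (f g : fn M U), open U -> pull (f * g) = pull f * pull g;
  pull_cst : forall U c, open U ->
    pull (cst U c) = cst (bmap @^-1` U) c;
  pull_deg : forall U k (f : fn M U), open U -> hdeg k f -> hdeg k (pull f);
  pull_res : forall U V (f : fn M U), open U -> open_in U V ->
    res (bmap @^-1` U) (bmap @^-1` V) (pull f) = pull (res U V f) }.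

Arguments pull {R N M} pi {U} : rename.

(** [z] completes the coordinates pulled back from the base to coordinates on
    the whole preimage, the body of which is a product with a vector space. *)
Definition fibre_coordinates (R : realType) (N M : supermanifold R)
    (pi : smap N M) (V : set M) (I : finType) (deg : I -> int) (x : I -> fn M V)
    (J : finType) (degJ : J -> int) (z : J -> fn N (pi @^-1` V)) : Prop :=
  forall kap ev, chart_on deg x kap ev ->
    exists kap' ev', [/\
      chart_on (sum_fam deg degJ) (sum_fam (fun i => pull pi (x i)) z) kap' ev',
      forall q i, V (pi q) -> kap' q (inl i) = kap (pi q) i &
      kap' @` (pi @^-1` V) =
        [set w | body_space (sum_fam deg degJ) w /\
                 (kap @` V) (fun i => w (inl i))]].

(** * Vector fields *)

Section VectorFields.
Variables (R : realType) (X : supermanifold R).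

Definition operator := forall U : set X, fn X U -> fn X U.

Record vfield (V : set X) (k : int) (D : operator) : Prop := {
  vf_open : open V;
  vfB : forall U f g, open_in V U -> D U (f - g) = D U f - D U g;
  vf_cst : forall U c, open_in V U -> D U (cst U c) = 0;
  vf_res : forall U W f, open_in V U -> open_in U W ->
    res U W (D U f) = D W (res U W f);
  vf_deg : forall U l f, open_in V U -> hdeg l f -> hdeg (k + l) (D U f);
  vf_leibniz : forall U l f g, open_in V U -> hdeg l f ->
    D U (f * g) = D U f * g + ksign (k * l) * (f * D U g) }.

Definition gcommutator (k l : int) (D D' : operator) : operator :=
  fun U f => D U (D' U f) - ksign (k * l) * D' U (D U f).

Definition coordinate_vfields (V : set X) (I : finType) (deg : I -> int)
    (x : I -> fn X V) (partial : I -> operator) : Prop :=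
  forall i, vfield V (- deg i) (partial i) /\
            forall j, partial i V (x j) = (i == j)%:R.

End VectorFields.

Arguments operator {R} X.

(** * Vector bundles, through their graded sheaf of sections *)

Record bundle_data (R : realType) (M : supermanifold R) := BundleData {
  sect : forall U : set M, lmodType (fn M U);
  sres : forall U V, sect U -> sect V;
  sdeg : forall U, int -> sect U -> Prop }.

Arguments sect {R M} E U : rename.
Arguments sres {R M E} U V s : rename.
Arguments sdeg {R M E U} k s : rename.

Record frame (R : realType) (M : supermanifold R) (E : bundle_data M)
    (V : set M) (A : finType) (p : A -> int) (X : A -> sect E V) : Prop := {
  fr_open : open V;
  fr_deg : forall a, sdeg (p a) (X a);
  fr_basis : forall U (s : sect E U), open_in V U ->
    exists! g : A -> fn M U, s = \sum_a g a *: sres V U (X a) }.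

Record vbundle (R : realType) (M : supermanifold R) := VBundle {
  vb_data :> bundle_data M;
  vb_sheaf : graded_sheaf (S := fun U => sect vb_data U : zmodType)
    (@sres R M vb_data) (@sdeg R M vb_data);
  vb_resZ : forall U V (f : fn M U) (s : sect vb_data U),
    open U -> open_in U V -> sres U V (f *: s) = res U V f *: sres U V s;
  vb_degZ : forall U k l (f : fn M U) (s : sect vb_data U),
    open U -> hdeg k f -> sdeg l s -> sdeg (k + l) (f *: s);
  vb_frames : forall m : M, exists (V : set M) (A : finType) (p : A -> int)
    (X : A -> sect vb_data V), V m /\ frame p X }.

(** [total_space k E N]: [N] is the total space of [E] with fibre coordinates
    shifted up by [k]; [N] is the bundle itself for k = 0 and [-1]E for k = 1.
    [tcoord X] are the (shifted) fibre coordinates dual to the frame [X], of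
    degrees [k - |X a|]. For k = 0 duality means l^a(X_b) = delta_ab, linear
    functions satisfying l(fX) = (-1)^(|l||f|) f l(X); this gives the change of
    coordinates [tcoord_change]. Its coefficients are kept when the coordinates
    are shifted; for k = 1 it also reads l^a = sum_b l'^b g_b^a. *)
Record total_space (R : realType) (M : supermanifold R) (k : int)
    (E : vbundle M) (N : supermanifold R) := TotalSpace {
  tproj :> smap N M;
  tcoord : forall (V : set M) (A : finType),
    (A -> sect E V) -> A -> fn N (tproj @^-1` V);
  tcoord_chart : forall V (A : finType) (p : A -> int) (X : A -> sect E V)
      (I : finType) (deg : I -> int) (x : I -> fn M V),
    frame p X -> chart deg x ->
    fibre_coordinates deg x (fun a => k - p a) (tcoord X);
  tcoord_deg : forall V (A : finType) (p : A -> int) (X : A -> sect E V) a,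
    frame p X -> hdeg (k - p a) (tcoord X a);
  tcoord_change : forall V V' (A A' : finType) (p : A -> int) (p' : A' -> int)
      (X : A -> sect E V) (X' : A' -> sect E V') (g : A' -> A -> fn M V'),
    frame p X -> frame p' X' -> open_in V V' ->
    (forall b, X' b = \sum_a g b a *: sres V V' (X a)) ->
    forall a, res (tproj @^-1` V) (tproj @^-1` V') (tcoord X a) =
      \sum_b ksign (p a * (p' b - p a)) * (pull tproj (g b a) * tcoord X' b) }.

Arguments tcoord {R M k E N} t {V A} X a : rename.

(** * The odd tangent bundle and its Cartan calculus

    The differential of a function [f] on [N] is [dR] applied to the pullback
    of [f]; only homogeneous vector fields are contracted. *)

Record odd_tangent (R : realType) (N P : supermanifold R) := OddTangent {
  oproj :> smap P N;
  dR : operator P;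
  contraction : operator N -> operator P;
  dR_vfield : vfield setT 1 dR;
  dR_dR : forall V (f : fn N V), open V ->
    dR (dR (pull oproj f)) = 0;
  dR_chart : forall V (I : finType) (deg : I -> int) (x : I -> fn N V),
    chart deg x ->
    fibre_coordinates deg x (fun i => deg i + 1) (fun i => dR (pull oproj (x i)));
  contraction_vfield : forall V k Y, vfield V k Y ->
    vfield (oproj @^-1` V) (k - 1) (contraction Y);
  contraction_fn : forall V k Y U (f : fn N U), vfield V k Y -> open_in V U ->
    contraction Y (pull oproj f) = 0;
  contraction_d : forall V k Y U (f : fn N U), vfield V k Y -> open_in V U ->
    contraction Y (dR (pull oproj f)) = pull oproj (Y U f) }.

Arguments dR {R N P} t [U] f : rename.
Arguments contraction {R N P} t Y [U] f : rename.

(** The Lie derivative along a vector field of degree [k]. *)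
Definition Lie (R : realType) (N P : supermanifold R) (t : odd_tangent N P)
    (k : int) (Y : operator N) : operator P :=
  gcommutator (k - 1) 1 (contraction t Y) (dR t).

(** * Anchored brackets and algebroids *)

Record anchored_bracket (R : realType) (M : supermanifold R) (E : vbundle M) :=
    AnchoredBracket {
  anchor : forall V : set M, sect E V -> operator M;
  bracket : forall V : set M, sect E V -> sect E V -> sect E V;
  anchor_vfield : forall V k (X : sect E V), open V -> sdeg k X ->
    vfield V k (anchor X);
  anchorB : forall V (X Y : sect E V) U f, open V -> open_in V U ->
    anchor (X - Y) (U := U) f = anchor X f - anchor Y f;
  anchorZ : forall V (g : fn M V) (X : sect E V) U f, open V -> open_in V U ->
    anchor (g *: X) (U := U) f = res V U g * anchor X f;
  anchor_res : forall V W (X : sect E V) U f, open V -> open_in V W ->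
    open_in W U -> anchor (sres V W X) (U := U) f = anchor X f;
  bracketBl : forall V (X Y Z : sect E V), open V ->
    bracket (X - Y) Z = bracket X Z - bracket Y Z;
  bracketBr : forall V (X Y Z : sect E V), open V ->
    bracket X (Y - Z) = bracket X Y - bracket X Z;
  bracket_res : forall V W (X Y : sect E V), open V -> open_in V W ->
    sres V W (bracket X Y) = bracket (sres V W X) (sres V W Y);
  bracket_deg : forall V k l (X Y : sect E V), open V ->
    sdeg k X -> sdeg l Y -> sdeg (k + l) (bracket X Y);
  bracket_skew : forall V k l (X Y : sect E V), open V ->
    sdeg k X -> sdeg l Y -> bracket X Y = - (ksign (k * l) *: bracket Y X);
  bracket_leibniz : forall V k l (X Y : sect E V) (f : fn M V), open V ->
    sdeg k X -> hdeg l f ->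
    bracket X (f *: Y) = anchor X f *: Y + (ksign (k * l) * f) *: bracket X Y }.

Arguments anchor {R M E} b {V} X U f : rename.
Arguments bracket {R M E} b {V} X Y : rename.

Record algebroid (R : realType) (M : supermanifold R) (E : vbundle M) :=
    Algebroid {
  alg_bracket :> anchored_bracket E;
  jacobi : forall V k l (X Y Z : sect E V), open V -> sdeg k X -> sdeg l Y ->
    bracket alg_bracket X (bracket alg_bracket Y Z) =
    bracket alg_bracket (bracket alg_bracket X Y) Z +
    ksign (k * l) *: bracket alg_bracket Y (bracket alg_bracket X Z) }.

(** [Q] is the vector field on the shifted bundle [N] associated with [b]; note
    rho_a^i = rho(X_a)(x^i). *)
Definition associated_vfield (R : realType) (M : supermanifold R)
    (E : vbundle M) (b : anchored_bracket E) (N : supermanifold R)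
    (t : total_space 1 E N) (Q : operator N) : Prop :=
  vfield setT 1 Q /\
  forall (V : set M) (I : finType) (deg : I -> int) (x : I -> fn M V)
      (A : finType) (p : A -> int) (X : A -> sect E V) (c : A -> A -> A -> fn M V),
    chart deg x -> frame p X ->
    (forall a a', bracket b (X a) (X a') = \sum_g c a a' g *: X g) ->
    exists2 partial : I + A -> operator N,
      coordinate_vfields (sum_fam deg (fun a => 1 - p a))
        (sum_fam (fun i => pull t (x i)) (tcoord t X)) partial &
      forall U (F : fn N U), open_in (t @^-1` V) U ->
        Q U F =
          (\sum_a \sum_i
             res (t @^-1` V) U (tcoord t X a * pull t (anchor b (X a) V (x i)))
             * partial (inl i) U F)
        - (\sum_a \sum_a' \sum_g ksign (p a * (p a' - 1)) * (cst U 2^-1 *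
             res (t @^-1` V) U (tcoord t X a * tcoord t X a' * pull t (c a a' g))
             * partial (inr g) U F)).

(** * The bundle [-1]TA -> [-1]TM *)

(** Complete and vertical lifts of sections of [E] to sections of a bundle [B]
    over the odd tangent bundle of the base. *)
Record lifts (R : realType) (M : supermanifold R) (E : vbundle M)
    (TM : supermanifold R) (tM : odd_tangent M TM) (B : vbundle TM) := Lifts {
  clift : forall V : set M, sect E V -> sect B (tM @^-1` V);
  vlift : forall V : set M, sect E V -> sect B (tM @^-1` V);
  cliftB : forall V (X Y : sect E V), open V ->
    clift (X - Y) = clift X - clift Y;
  vliftB : forall V (X Y : sect E V), open V ->
    vlift (X - Y) = vlift X - vlift Y;
  clift_res : forall V W (X : sect E V), open V -> open_in V W ->
    sres (tM @^-1` V) (tM @^-1` W) (clift X) = clift (sres V W X);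
  vlift_res : forall V W (X : sect E V), open V -> open_in V W ->
    sres (tM @^-1` V) (tM @^-1` W) (vlift X) = vlift (sres V W X);
  clift_deg : forall V k (X : sect E V), open V -> sdeg k X -> sdeg k (clift X);
  vlift_deg : forall V k (X : sect E V), open V ->
    sdeg k X -> sdeg (k - 1) (vlift X);
  lift_frame : forall V (A : finType) (p : A -> int) (X : A -> sect E V),
    frame p X ->
    frame (sum_fam p (fun a => p a - 1))
      (sum_fam (fun a => clift (X a)) (fun a => - vlift (X a)));
  cliftZ : forall V k l (f : fn M V) (X : sect E V), open V ->
    hdeg l f -> sdeg k X ->
    clift (f *: X) = pull tM f *: clift X +
      (ksign (k + l) * dR tM (pull tM f)) *: vlift X;
  vliftZ : forall V (f : fn M V) (X : sect E V), open V ->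
    vlift (f *: X) = pull tM f *: vlift X }.

Arguments clift {R M E TM tM B} L {V} X : rename.
Arguments vlift {R M E TM tM B} L {V} X : rename.

Definition lift_fam (R : realType) (M : supermanifold R) (E : vbundle M)
    (TM : supermanifold R) (tM : odd_tangent M TM) (B : vbundle TM)
    (L : lifts E tM B) (V : set M) (A : Type) (X : A -> sect E V) :
    A + A -> sect B (tM @^-1` V) :=
  sum_fam (fun a => clift L (X a)) (fun a => - vlift L (X a)).

(** [P] carries two structures: odd tangent bundle of the shifted bundle [N],
    and shift of the bundle [B] over [TM]. They agree: the two ways down to [M]
    coincide, [P -> TM] commutes with differentials of functions on [M], and
    the coordinates dual to {X_a^C, - X_a^V} are {l^a, d l^a}.
    With k = 0 this says that [B] is the bundle [-1]TA -> [-1]TM and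
    characterizes the lifts; with k = 1 it is the identification of
    [-1]_{[-1]TM}([-1]TA) with [-1]T([-1]A). *)
Record double_bundle (R : realType) (M : supermanifold R) (k : int)
    (E : vbundle M) (N : supermanifold R) (n : total_space k E N)
    (TM : supermanifold R) (tM : odd_tangent M TM)
    (P : supermanifold R) (tN : odd_tangent N P)
    (B : vbundle TM) (L : lifts E tM B) (b : total_space k B P) : Prop := {
  db_body : forall q, tM (b q) = n (tN q);
  db_fn : forall V (f : fn M V), open V ->
    res (b @^-1` (tM @^-1` V)) (tN @^-1` (n @^-1` V))
      (pull b (pull tM f)) = pull tN (pull n f);
  db_dfn : forall V (f : fn M V), open V ->
    res (b @^-1` (tM @^-1` V)) (tN @^-1` (n @^-1` V))
      (pull b (dR tM (pull tM f))) = dR tN (pull tN (pull n f));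
  db_clift : forall V (A : finType) (p : A -> int) (X : A -> sect E V) a,
    frame p X ->
    res (b @^-1` (tM @^-1` V)) (tN @^-1` (n @^-1` V))
      (tcoord b (lift_fam L X) (inl a)) = pull tN (tcoord n X a);
  db_vlift : forall V (A : finType) (p : A -> int) (X : A -> sect E V) a,
    frame p X ->
    res (b @^-1` (tM @^-1` V)) (tN @^-1` (n @^-1` V))
      (tcoord b (lift_fam L X) (inr a)) = dR tN (pull tN (tcoord n X a)) }.

(** The anchor and bracket induced on [-1]TA -> [-1]TM. *)
Record lifted_bracket (R : realType) (M : supermanifold R) (E : vbundle M)
    (b : anchored_bracket E) (TM : supermanifold R) (tM : odd_tangent M TM)
    (B : vbundle TM) (L : lifts E tM B) (b' : anchored_bracket B) : Prop := {
  lb_anchor_c : forall V k (X : sect E V) U F, open V -> sdeg k X ->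
    open_in (tM @^-1` V) U ->
    anchor b' (clift L X) U F = Lie tM k (anchor b X) F;
  lb_anchor_v : forall V k (X : sect E V) U F, open V -> sdeg k X ->
    open_in (tM @^-1` V) U ->
    anchor b' (vlift L X) U F = contraction tM (anchor b X) F;
  lb_cc : forall V (X Y : sect E V), open V ->
    bracket b' (clift L X) (clift L Y) = clift L (bracket b X Y);
  lb_cv : forall V (X Y : sect E V), open V ->
    bracket b' (clift L X) (vlift L Y) = vlift L (bracket b X Y);
  lb_vv : forall V (X Y : sect E V), open V ->
    bracket b' (vlift L X) (vlift L Y) = 0 }.

(* Main.v *)
Require Import Defs.
From mathcomp Require Import all_boot all_order all_algebra.
From mathcomp Require Import all_classical all_reals all_analysis.
From mathcomp Require Import ring zify.

(** Both sides of the identity are vector fields of degree 1 on the same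
    supermanifold [P]: the right-hand side because a graded commutator of vector
    fields is one ([gcommutator_vfield]). The two are compared locally. Over an
    open set of the base with coordinates x and a frame [X a], the supermanifold
    [P] has coordinates x, dx, l, dl, where l are the shifted fibre coordinates
    dual to the frame, and on these the two vector fields agree by direct
    computation:

    - the Lie derivative along Q = d_A sends a function f of x, l to Q(f), and
      df to - d(Q f), so it is known on the coordinates from
      Q(x) = l^a rho_a and Q(l^g) = - (+-) 1/2 l^a l^b c_ab^g;
    - the vector field of the lifted bracket is known from its anchor and its
      structure functions in the frame X_a^C, - X_a^V: these are the c_ab^g, up
      to sign their differentials dc_ab^g, and zero ([lift_structure],
      [lift_fam_bracket]).

    The differential of l^a rho_a has two terms, matching complete and vertical
    lifts in the anchor; the differential of l^a l^b c_ab^g has three terms,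
    matching the brackets [C,C], [C,V], [V,C] ([agree_dx], [agree_dl]). That the
    c_ab^g may be taken homogeneous is [homogeneous_coefficients].

    What remains is that a vector field is determined by its values on
    coordinates ([vfield_unique]). Sections are locally polynomials in the
    coordinates of nonzero degree with coefficients that are smooth functions f
    of the others, so one has to see that a derivation D killing all
    coordinates kills such an f. This is Hadamard's argument: near a point a,
    f is the sum of a function of fewer coordinates and of (y_i - a_i) q with q
    smooth ([hadamard_coord]), hence by induction D f = (x_i - a_i) D q, which
    vanishes at a ([vfield_ev_eq0]). The function q is the integral of the i-th
    partial derivative of f along a segment; it is smooth because such parameter
    integrals are stable under partial differentiation ([parint_derive]). *)

Set Implicit Arguments.
Unset Strict Implicit.
Unset Printing Implicit Defensive.

Import Order.TTheory GRing.Theory Num.Theory.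
Import numFieldNormedType.Exports.

Local Open Scope classical_set_scope.
Local Open Scope ring_scope.

(** * Coordinate boxes *)

Section CoordinateBoxes.
Variables (R : realType) (I : finType).
Implicit Types (deg : I -> int) (U : set {ptws I -> R}) (f : (I -> R) -> R).

Definition upd (y : I -> R) (i : I) (t : R) : I -> R :=
  fun j => if j == i then t else y j.

Lemma upd_same (y : I -> R) i t : upd y i t i = t.
Proof. by rewrite /upd eqxx. Qed.

Lemma upd_id (y : I -> R) i : upd y i (y i) = y.
Proof. by apply/funext => j; rewrite /upd; case: eqP => [->|]. Qed.

Lemma upd_upd (y : I -> R) i s t : upd (upd y i s) i t = upd y i t.
Proof. by apply/funext => j; rewrite /upd; case: eqP. Qed.

Lemma upd_comm (y : I -> R) i j s t : i != j ->
  upd (upd y i s) j t = upd (upd y j t) i s.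
Proof.
move=> ij; apply/funext => k; rewrite /upd.
by case: (eqVneq k j) => // ->; rewrite eq_sym (negbTE ij).
Qed.

Definition near_pt (a : I -> R) (r : R) (y : I -> R) : Prop :=
  forall i, `|y i - a i| < r.

Lemma near_pt_refl a r : 0 < r -> near_pt a r a.
Proof. by move=> r0 i; rewrite subrr normr0. Qed.

Lemma near_pt_le a r s y : r <= s -> near_pt a r y -> near_pt a s y.
Proof. by move=> rs ay i; apply: lt_le_trans (ay i) rs. Qed.

Lemma near_pt_upd a r y i t :
  near_pt a r y -> `|t - a i| < r -> near_pt a r (upd y i t).
Proof. by move=> ay ta j; rewrite /upd; case: eqP => // ->. Qed.

Lemma open_near_pt (a : {ptws I -> R}) r : open (near_pt a r : set {ptws I -> R}).
Proof.
rewrite openE => y ay.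
have H (s : seq I) : nbhs y [set z : {ptws I -> R} |
    forall i, i \in s -> `|z i - a i| < r].
  elim: s => [|i s IH].
    by apply: filterS (@filterT _ (nbhs y) _) => z _ i; rewrite in_nil.
  have yi : nbhs y [set z : {ptws I -> R} | ball (y i) (r - `|y i - a i|) (z i)].
    apply: (@proj_continuous I (fun=> R) i y); apply: nbhsx_ballx.
    by rewrite subr_gt0; exact: ay.
  apply: filterS (filterI yi IH) => z [zi zs] j; rewrite inE => /orP[/eqP->|/zs//].
  move: zi; rewrite /ball/= ltrBrDr; apply: le_lt_trans.
  by rewrite (distrC (y i)); exact: ler_distD.
apply: (@filterS _ (nbhs y) _ _ _ _ (H (enum I))) => z zP i.
by apply: (zP i); rewrite mem_enum.
Qed.

Lemma nbhs_near_pt (a : {ptws I -> R}) r : 0 < r -> nbhs a (near_pt a r).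
Proof.
move=> r0; apply: open_nbhs_nbhs; split; first exact: open_near_pt.
exact: near_pt_refl.
Qed.

(** The filter generated by the boxes around [a] converges to [a] coordinatewise,
    hence is finer than the neighbourhoods of [a] in the pointwise topology;
    finiteness of [I] makes the boxes themselves neighbourhoods. *)
Lemma nbhs_near_ptP (a : {ptws I -> R}) (G : set {ptws I -> R}) :
  nbhs a G <-> exists2 r, 0 < r & forall y, near_pt a r y -> G y.
Proof.
split=> [aG|[r r0 rG]]; last first.
  exact: (@filterS _ (nbhs a) _ _ _ rG (nbhs_near_pt a r0)).
pose F : set_system (I -> R) := filter_from [set r | 0 < r] (near_pt a).
have FF : Filter F.
  apply: filter_from_filter; first by exists 1 => /=.
  move=> r s /= r0 s0; exists (Num.min r s) => /=; first by rewrite lt_min r0.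
  by move=> y h; split; apply: near_pt_le h; rewrite ge_min lexx ?orbT.
have Fa : F --> (a : {ptws I -> R}).
  apply/cvg_sup => i U [V [[W oW <-] Wa] WU]; apply: (@filterS _ F _ _ _ WU).
  have /nbhs_ballP [e e0 eW] : nbhs (a i) W by exact: open_nbhs_nbhs.
  by exists e => //= y ay; apply: eW; rewrite /ball/= distrC.
by have [r /= r0 rG] := Fa _ aG; exists r.
Qed.

(** Continuity on [U] in coordinates; unlike the filter formulation it leaves
    room for estimates that are uniform in a parameter. *)
Definition cont_on U f : Prop := forall y, U y -> forall e, 0 < e ->
  exists2 d, 0 < d & forall z, U z -> near_pt y d z -> `|f z - f y| < e.

Lemma cont_onP U f :
  {within U, continuous (f : {ptws I -> R} -> R)} <-> cont_on U f.
Proof.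
split.
  move=> /subspace_continuousP fU y Uy e e0.
  have /cvgrPdist_lt/(_ _ e0) := fU _ Uy.
  rewrite near_withinE => /nbhs_near_ptP [d d0 H]; exists d => // z Uz yz.
  by rewrite distrC; apply: H.
move=> fU; apply/subspace_continuousP => y Uy; apply/cvgrPdist_lt => e e0.
rewrite near_withinE; apply/nbhs_near_ptP.
by have [d d0 H] := fU y Uy e e0; exists d => // z yz Uz; rewrite distrC; apply: H.
Qed.

Lemma cont_onW U V f : V `<=` U -> cont_on U f -> cont_on V f.
Proof.
move=> VU fU y Vy e e0; have [d d0 H] := fU y (VU _ Vy) e e0.
by exists d => // z /VU; exact: H.
Qed.

End CoordinateBoxes.

(** * Smooth functions *)

Section Regular.
Variables (R : realType) (I : finType) (deg : I -> int).
Implicit Types (U : set {ptws I -> R}) (f g : (I -> R) -> R).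

(** What differentiation at the points of [U] needs from [U] when [U] is only
    open inside the subspace where the other coordinates vanish. *)
Definition slice_open U : Prop := forall y i, U y -> deg i = 0 ->
  \forall t \near y i, U (upd y i t).

Lemma slice_upd f y i s : slice f (upd y i s) i = slice f y i.
Proof.
by apply/funext => t; rewrite /slice -/(upd _ i t) upd_upd.
Qed.

Lemma pderivE i f y : pderiv i f y = 'D_1 (slice f y i) (y i).
Proof. by rewrite /pderiv derive1E. Qed.

(** Stratifying smoothness by the order of differentiation makes closure
    properties provable by induction: a product or a parameter integral is
    reached through its first partial derivatives, which are again sums,
    products or parameter integrals, one order lower. *)
Fixpoint class_C (m : nat) U f : Prop :=
  match m with
  | 0 => cont_on U f
  | m'.+1 => cont_on U f /\ forall i, deg i = 0 ->
      (forall y, U y -> derivable (slice f y i) (y i) 1) /\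
      class_C m' U (pderiv i f)
  end.

Lemma class_C_cont m U f : class_C m U f -> cont_on U f.
Proof. by case: m => //= m []. Qed.

Lemma class_CS m U f : class_C m.+1 U f -> class_C m U f.
Proof.
elim: m U f => [|m IH] U f /=; first by case.
move=> [fU H]; split=> // i di; have [fd H'] := H i di.
by split=> //; apply: IH.
Qed.

Lemma smoothP U f : smooth deg U f <-> forall m, class_C m U f.
Proof.
split=> [fU m|].
  have H : forall s, all (fun i => deg i == 0) s -> class_C m U (pderivs s f).
    elim: m => [|m IH] s sd /=; have [/cont_onP fc fd] := fU s sd; first by [].
    split=> // i di; split=> [y Uy|]; first exact: fd.
    by apply: (IH (i :: s)); rewrite /= di eqxx.
  exact: (H [::]).
move=> H s sd; suff H1: forall m, class_C m U (pderivs s f).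
  split; first by apply/cont_onP; exact: (H1 0%N).
  by move=> y i Uy di; have [_ /(_ i di) [+ _]] := H1 1%N; apply.
elim: s sd => [_|i s IH /= /andP[/eqP di sd]] m; first exact: H.
by have [_ /(_ i di) []] := IH sd m.+1.
Qed.

Lemma class_CW U V m f : V `<=` U -> class_C m U f -> class_C m V f.
Proof.
move=> VU; elim: m f => [|m IH] f /=; first exact: cont_onW.
move=> [fU H]; split; first exact: cont_onW fU.
move=> i di; have [fd H'] := H i di; split; last exact: IH.
by move=> y /VU; apply: fd.
Qed.

Lemma smoothW U V f : V `<=` U -> smooth deg U f -> smooth deg V f.
Proof. by move=> VU /smoothP fU; apply/smoothP => m; apply: class_CW (fU m). Qed.

Lemma near_slice_eq U f g y i : slice_open U -> (forall z, U z -> f z = g z) ->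
  U y -> deg i = 0 -> {near y i, slice f y i =1 slice g y i}.
Proof.
move=> oU fg Uy di; apply: filterS (oU _ _ Uy di) => t; exact: fg.
Qed.

Lemma pderiv_eq U f g y i : slice_open U -> (forall z, U z -> f z = g z) ->
  U y -> deg i = 0 -> pderiv i f y = pderiv i g y.
Proof.
move=> oU fg Uy di; rewrite !pderivE; apply: near_eq_derive.
exact: near_slice_eq fg Uy di.
Qed.

Lemma class_C_eq m U f g : slice_open U -> (forall z, U z -> f z = g z) ->
  class_C m U f -> class_C m U g.
Proof.
move=> oU; elim: m f g => [|m IH] f g fg.
  by move=> fU y Uy e e0; have [d d0 H] := fU y Uy e e0; exists d => // z Uz;
    rewrite -!fg//; exact: H.
move=> [fU H]; split.
  by move=> y Uy e e0; have [d d0 H'] := fU y Uy e e0; exists d => // z Uz;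
    rewrite -!fg//; exact: H'.
move=> i di; have [fd H'] := H i di; split=> [y Uy|].
  by apply: near_eq_derivable (fd y Uy); exact: near_slice_eq fg Uy di.
by apply: IH H' => y Uy; apply: pderiv_eq fg Uy di.
Qed.

Lemma cont_onP_cvg U f : cont_on U f <-> forall y, U y ->
  f z @[z --> within U (nbhs (y : {ptws I -> R}))] --> f y.
Proof. by rewrite -cont_onP; apply: subspace_continuousP. Qed.

Lemma cont_onD U f g : cont_on U f -> cont_on U g ->
  cont_on U (fun y => f y + g y).
Proof.
rewrite !cont_onP_cvg => fU gU y Uy.
by apply: cvgD; [exact: fU | exact: gU].
Qed.

Lemma cont_onM U f g : cont_on U f -> cont_on U g ->
  cont_on U (fun y => f y * g y).
Proof.
rewrite !cont_onP_cvg => fU gU y Uy.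
by apply: cvgM; [exact: fU | exact: gU].
Qed.

Lemma class_CD m U f g : slice_open U -> class_C m U f -> class_C m U g ->
  class_C m U (fun y => f y + g y).
Proof.
move=> oU; elim: m f g => [|m IH] f g; first exact: cont_onD.
move=> [fU fH] [gU gH]; split; first exact: cont_onD.
move=> i di; have [fd fH'] := fH i di; have [gd gH'] := gH i di; split.
  by move=> y Uy; apply: derivableD; [exact: fd | exact: gd].
apply: class_C_eq (IH _ _ fH' gH') => // y Uy.
by rewrite !pderivE; apply/esym/deriveD; [exact: fd | exact: gd].
Qed.

Lemma class_CM m U f g : slice_open U -> class_C m U f -> class_C m U g ->
  class_C m U (fun y => f y * g y).
Proof.
move=> oU; elim: m f g => [|m IH] f g; first exact: cont_onM.
move=> /[dup] /class_CS fm [fU fH] /[dup] /class_CS gm [gU gH].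
split; first exact: cont_onM.
move=> i di; have [fd fH'] := fH i di; have [gd gH'] := gH i di; split.
  by move=> y Uy; apply: derivableM; [exact: fd | exact: gd].
apply: class_C_eq (class_CD oU (IH _ _ fm gH') (IH _ _ gm fH')) => // y Uy.
rewrite !pderivE; apply/esym; rewrite [LHS](deriveM (fd _ Uy) (gd _ Uy)).
by rewrite /slice -/(upd y i (y i)) upd_id.
Qed.

Lemma smoothD U f g : slice_open U -> smooth deg U f -> smooth deg U g ->
  smooth deg U (fun y => f y + g y).
Proof.
by move=> oU /smoothP fU /smoothP gU; apply/smoothP => m; exact: class_CD.
Qed.

Lemma smoothM U f g : slice_open U -> smooth deg U f -> smooth deg U g ->
  smooth deg U (fun y => f y * g y).
Proof.
by move=> oU /smoothP fU /smoothP gU; apply/smoothP => m; exact: class_CM.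
Qed.

Lemma slice_cst c y i : slice (fun _ : I -> R => c) y i = cst c.
Proof. by []. Qed.

Lemma class_C_cst m U c : class_C m U (fun=> c).
Proof.
have C c' : cont_on U (fun=> c').
  by move=> y Uy e e0; exists 1 => // z _ _; rewrite subrr normr0.
elim: m c => [|m IH] c; first exact: C.
split=> [|i di]; first exact: C.
split=> [y Uy|]; first exact: derivable_cst.
rewrite (_ : pderiv i _ = fun=> 0); first exact: IH.
by apply/funext => y; rewrite pderivE slice_cst derive_cst.
Qed.

Lemma smooth_cst U c : smooth deg U (fun=> c).
Proof. by apply/smoothP => m; exact: class_C_cst. Qed.

Lemma smooth_coord U i : smooth deg U (fun y => y i).
Proof.
have C : cont_on U (fun y => y i).
  by move=> y Uy e e0; exists e => // z _; apply.
apply/smoothP => -[|m]; first exact: C.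
split=> // j dj.
have E y : slice (fun y => y i) y j = if i == j then id else cst (y i).
  by apply/funext => t; rewrite /slice; case: eqP.
split=> [y Uy|].
  by rewrite E; case: eqP => _; [exact: derivable_id | exact: derivable_cst].
rewrite (_ : pderiv j _ = fun=> (i == j)%:R); first exact: class_C_cst.
apply/funext => y; rewrite pderivE E; case: eqP => _.
  by rewrite derive_id.
by rewrite derive_cst.
Qed.

End Regular.

(** * Hadamard's lemma *)

Section Box_segments.
Variables (R : realType) (I : finType) (deg : I -> int).
Variables (a : I -> R) (r : R).

Definition box : set {ptws I -> R} :=
  [set y | body_space deg y /\ near_pt a r y].

Lemma box_upd y i t : deg i = 0 -> box y -> `|t - a i| < r -> box (upd y i t).
Proof.
move=> di [yb ya] ta; split; last exact: near_pt_upd.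
by move=> j dj; rewrite /upd; case: eqP => [ji|_]; [rewrite ji di in dj | exact: yb].
Qed.

Lemma box_slice_open : slice_open deg box.
Proof.
move=> y i By di; have : \forall t \near y i, `|t - a i| < r.
  have Ha : `|y i - a i| < r by case: By => _; apply.
  have H0 : 0 < r - `|y i - a i| by rewrite subr_gt0.
  apply: filterS (nbhsx_ballx (y i) _ H0) => t; rewrite /ball/= ltrBrDr.
  by apply: le_lt_trans; rewrite (distrC (y i) t); exact: ler_distD.
by apply: filterS => t; exact: box_upd.
Qed.

Variables (i : I) (di : deg i = 0).

(** Parametrized so that [seg 1 y] is [y] and [seg 0 y] is the projection of [y]
    to the hyperplane through [a] on which the coordinate [i] is constant. *)
Definition seg (t : R) (y : I -> R) : I -> R := upd y i (a i + t * (y i - a i)).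

Lemma box_seg t y : 0 <= t <= 1 -> box y -> box (seg t y).
Proof.
move=> /andP[t0 t1] By; apply: box_upd => //.
rewrite addrAC subrr add0r normrM (ger0_norm t0).
by case: By => _ /(_ i); apply: le_lt_trans; rewrite ler_piMl.
Qed.

(** The segment depends on its endpoint and on its parameter in a Lipschitz
    way, with constants 1 and [r]. *)
Lemma seg_near t t' y z e : 0 <= t' <= 1 -> 0 < e -> box y ->
  near_pt y (e / 2) z -> `|t' - t| * r < e / 2 -> near_pt (seg t y) e (seg t' z).
Proof.
move=> /andP[t0 t1] e0 [_ yr] yz tt j; rewrite /seg /upd; case: eqP => _; last first.
  by apply: lt_trans (yz j) _; rewrite ltr_pdivrMr// ltr_pMr// ltr1n.
rewrite (_ : _ - _ = t' * (z i - y i) + (t' - t) * (y i - a i)); last first.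
  by ring.
rewrite (splitr e); apply: le_lt_trans (ler_normD _ _) _; rewrite !normrM.
apply: ltr_leD; last first.
  apply: le_trans (ltW tt); apply: ler_wpM2l => //; exact: ltW.
rewrite (ger0_norm t0); apply: le_lt_trans (yz i).
by rewrite ler_piMl.
Qed.

(** Compactness of the segment turns continuity into continuity that is
    uniform along it. *)
Lemma seg_uniform psi y e : cont_on box psi -> box y -> 0 < e ->
  exists2 d, 0 < d & forall z, box z -> near_pt y d z ->
    forall t, 0 <= t <= 1 -> `|psi (seg t z) - psi (seg t y)| < e.
Proof.
move=> cpsi By e0.
have r0 : 0 < r by case: By => _ /(_ i); apply: le_lt_trans.
have /compact_near_coveringP/near_covering_withinP := @segment_compact R 0 1.
pose P (d t : R) := forall z, box z -> near_pt y d z ->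
  `|psi (seg t z) - psi (seg t y)| < e.
move=> /(_ R (0 : R)^'+ P _) H.
have : \forall d \near (0:R)^'+, `[0, 1] `<=` P d.
  apply: H => t t01.
  have e20 : 0 < e / 2 by rewrite divr_gt0.
  have [d d0 Hd] := cpsi (seg t y) (box_seg t01 By) _ e20.
  have d20 : 0 < d / 2 by rewrite divr_gt0.
  exists (ball t (d / 2 / r), [set d' | d' < d / 2]).
    split => /=; first by apply: nbhsx_ballx; rewrite divr_gt0.
    exact: nbhs_right_lt.
  move=> [t' d'] /= [tt dd] t'01 z Bz yz.
  have tr : `|t' - t| * r < d / 2.
    by rewrite -ltr_pdivlMr// distrC.
  rewrite (splitr e) (_ : psi (seg t' z) - psi (seg t' y) =
    (psi (seg t' z) - psi (seg t y)) + - (psi (seg t' y) - psi (seg t y))); last first.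
    by rewrite opprB addrA subrK.
  apply: le_lt_trans (ler_normD _ _) _; rewrite normrN.
  apply: ltrD; apply: Hd; try exact: box_seg.
    by apply: seg_near => //; apply: near_pt_le yz; exact: ltW.
  by apply: seg_near => //; exact: near_pt_refl.
move=> {}H; near (0:R)^'+ => d; exists d => // z Bz yz t t01.
by have := near H d; apply.
Unshelve. all: end_near. Qed.

End Box_segments.

Section ParameterIntegral.
Variables (R : realType) (I : finType) (deg : I -> int).
Variables (a : I -> R) (r : R) (i : I) (di : deg i = 0).
Local Notation box := (box deg a r).
Local Notation seg := (seg a i).

Definition integrand (n : nat) (psi : (I -> R) -> R) (y : I -> R) (t : R) : R :=
  t ^+ n * psi (seg t y).

(** The parameter integral of Hadamard's lemma. The power [t ^+ n] is carried
    along because differentiating in the direction of the segment produces one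
    more factor [t], so that the family is closed under all partial derivatives. *)
Definition parint n psi y : R :=
  \int[lebesgue_measure]_(t in `[0, 1]) integrand n psi y t.

Lemma integrand_continuous n psi y : cont_on box psi -> box y ->
  {within `[0, 1], continuous (integrand n psi y)}.
Proof.
move=> cpsi By; apply/subspace_continuousP => t t01; apply: cvgM.
  by apply: cvg_within_filter; exact: exprn_continuous.
apply/cvgrPdist_lt => e e0; rewrite near_withinE.
have r0 : 0 < r by case: By => _ /(_ i); apply: le_lt_trans.
have [d d0 Hd] := cpsi (seg t y) (box_seg di t01 By) _ e0.
have d0' : 0 < d / 2 / r by rewrite !divr_gt0.
apply: filterS (nbhsx_ballx t _ d0') => t'.
rewrite /ball/= ltr_pdivlMr// distrC => tt t01'; rewrite distrC; apply: Hd.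
  exact: box_seg.
have d20 : 0 < d / 2 by rewrite divr_gt0.
apply: seg_near d0 By _ tt; first by [].
exact: near_pt_refl.
Qed.

Lemma integrand_integrable n psi y : cont_on box psi -> box y ->
  lebesgue_measure.-integrable `[0, 1] (EFin \o integrand n psi y).
Proof.
move=> cpsi By; apply: continuous_compact_integrable.
  exact: segment_compact.
exact: integrand_continuous.
Qed.

Lemma integrand_le n psi y z t e : 0 <= t <= 1 ->
  `|psi (seg t z) - psi (seg t y)| < e ->
  `|integrand n psi z t - integrand n psi y t| <= e.
Proof.
move=> /andP[t0 t1] H; rewrite -mulrBr normrM (ger0_norm (exprn_ge0 _ t0)).
by apply: le_trans (ltW H); rewrite ler_piMl// exprn_ile1.
Qed.

Lemma parint_cont n psi : cont_on box psi -> cont_on box (parint n psi).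
Proof.
move=> cpsi y By e e0; have e20 : 0 < e / 2 by rewrite divr_gt0.
have [d d0 Hd] := seg_uniform di cpsi By e20.
exists d => // z Bz yz.
have mI := measurable_itv (`[(0 : R), 1] : interval R).
rewrite /parint -RintegralB//; try exact: integrand_integrable.
have iB : lebesgue_measure.-integrable `[0, 1]
    (EFin \o (fun t => integrand n psi z t - integrand n psi y t)).
  rewrite (_ : _ \o _ =
    (EFin \o integrand n psi z) \- (EFin \o integrand n psi y))%E; last first.
    by apply/funext => t.
  by apply: integrableB => //; exact: integrand_integrable.
apply: (@le_lt_trans _ _ (\int[lebesgue_measure]_(t in `[0, 1])
    `|integrand n psi z t - integrand n psi y t|)).
  exact: le_normr_Rintegral.
apply: (@le_lt_trans _ _ (\int[lebesgue_measure]_(t in `[0, 1]) (e / 2))).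
  apply: le_Rintegral => //.
  - exact: integrable_norm.
  - apply: continuous_compact_integrable; first exact: segment_compact.
    by apply: continuous_subspaceT; exact: cst_continuous.
  by move=> t t01; apply: integrand_le; last exact: Hd.
rewrite Rintegral_cst//= lebesgue_measure_itv/= lte_fin ltr01 /= oppr0 addr0.
by rewrite mulr1 ltr_pdivrMr// ltr_pMr// ltr1n.
Qed.

(** Moving the endpoint in another direction moves the segment rigidly; moving
    it in the direction [i] of the segment multiplies the speed by [t]. *)
Lemma integrand_derive n psi y j s t : deg j = 0 -> 0 <= t <= 1 ->
  (forall z, box z -> derivable (slice psi z j) (z j) 1) ->
  box (upd y j s) ->
  is_derive s 1 (fun s' => integrand n psi (upd y j s') t)
    (integrand (n + (j == i)) (pderiv j psi) (upd y j s) t).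
Proof.
move=> dj t01 dpsi Bs; have Bst := box_seg di t01 Bs.
have D : is_derive (seg t (upd y j s) j) 1 (slice psi (seg t (upd y j s)) j)
    (pderiv j psi (seg t (upd y j s))).
  by rewrite pderivE; apply: DeriveDef => //; exact: dpsi.
rewrite /integrand; case: (eqVneq j i) => [ji|ji]; last first.
  have E s' : seg t (upd y j s') = upd (seg t y) j s'.
    by rewrite /seg upd_comm// /upd (eq_sym i j) (negbTE ji).
  move: D; rewrite addn0 E upd_same slice_upd => D.
  under eq_fun do rewrite E.
  exact: (@is_deriveZ _ _ _ _ _ _ _ _ D).
move: Bs Bst dpsi D; rewrite ji => Bs Bst dpsi D.
have E s' : seg t (upd y i s') = upd y i (a i + t * (s' - a i)).
  by rewrite /seg upd_upd upd_same.
move: D; rewrite E upd_same slice_upd => D.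
under eq_fun do rewrite E.
have D2 : is_derive s 1 (fun s' => a i + t * (s' - a i)) t.
  apply: is_derive_eq.
  by rewrite /GRing.scale/=; ring.
have D3 := @is_derive1_comp R (slice psi y i)
  (fun s' => a i + t * (s' - a i)) _ _ _ D D2.
apply: is_derive_eq.
by rewrite addn1 exprSr /GRing.scale/=; ring.
Qed.

(** Differentiation under the integral sign. Near [y] the differentiated
    integrand differs by at most 1 from its value at [y], uniformly along the
    segment, which gives the integrable bound. *)
Lemma parint_derive n psi y j : deg j = 0 -> class_C deg 1 box psi -> box y ->
  is_derive (y j) 1 (slice (parint n psi) y j)
    (parint (n + (j == i)) (pderiv j psi) y).
Proof.
move=> dj [cpsi H] By; have [dpsi cdpsi] := H j dj; rewrite {H} /= in cdpsi.
pose n' := (n + (j == i))%N; set psi' := pderiv j psi in cdpsi *.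
(* The tolerance 1 is the constant in the bound [K]. *)
have [d d0 Hd] := seg_uniform di cdpsi By (@ltr01 R).
have /nbhs_ballP [d1 /= d10 Hd1] := box_slice_open By dj.
pose d' := Num.min d d1.
have d'0 : 0 < d' by rewrite lt_min d0.
pose Ij : set R := (`]y j - d', y j + d'[)%classic.
have IjP s : Ij s -> box (upd y j s) /\ near_pt y d (upd y j s).
  rewrite /Ij/= in_itv/= -ltr_distl lt_min => /andP[sd sd1]; split.
    by apply: Hd1; rewrite /ball/= distrC.
  by move=> k; rewrite /upd; case: eqP => [->//|_]; rewrite subrr normr0.
have Iy : Ij (y j) by rewrite /Ij/= in_itv/= ltrBlDr ltrDl d'0.
pose f s t := integrand n psi (upd y j s) t.
have fD s t : Ij s -> 0 <= t <= 1 ->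
    is_derive s 1 (f ^~ t) (integrand n' psi' (upd y j s) t).
  by move=> /IjP[Bs _] t01; exact: integrand_derive.
pose K t := `|integrand n' psi' y t| + 1.
have intf s : Ij s -> lebesgue_measure.-integrable `[0, 1] (EFin \o f s).
  by move=> /IjP[Bs _]; exact: integrand_integrable.
have K0 t : 0 <= K t by rewrite addr_ge0.
have intK : lebesgue_measure.-integrable `[0, 1] (EFin \o K).
  apply: continuous_compact_integrable; first exact: segment_compact.
  move=> t; apply: cvgD; last exact: cvg_cst.
  by apply: cvg_norm; exact: integrand_continuous.
have Kub s t : Ij s -> `[0, 1]%classic t -> `|partial1of2 f s t| <= K t.
  move=> Is t01; have [Bs ns] := IjP s Is.
  rewrite partial1of2E; have fst := fD s t Is t01.
  rewrite derive_val -(subrK (integrand n' psi' y t) (integrand _ _ _ _)).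
  rewrite addrC; apply: le_trans (ler_normD _ _) _; apply: lerD => //.
  by apply: integrand_le => //; exact: Hd.
have df s t : Ij s -> `[0, 1]%classic t -> derivable (f ^~ t) s 1.
  by move=> Is t01; have fst := fD s t Is t01; exact: ex_derive.
have mI := measurable_itv (`[(0 : R), 1] : interval R).
have D1 := @derivable_under_integral R _ _ (@lebesgue_measure R)
  f _ (measurable_itv _) _ _ _ Iy intf df K K0 intK Kub.
have D2 := @differentiation_under_integral R _ _ (@lebesgue_measure R)
  f _ (measurable_itv _) _ _ _ Iy intf df K K0 intK Kub.
apply: DeriveDef; first exact: D1.
rewrite -derive1E [LHS]D2; apply: eq_Rintegral => t; rewrite inE => t01.
have fyt := fD (y j) t Iy t01.
by rewrite partial1of2E derive_val upd_id.
Qed.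
End ParameterIntegral.

Section HadamardLemma.
Variables (R : realType) (I : finType) (deg : I -> int).
Variables (a : I -> R) (r : R).
Local Notation box := (box deg a r).

Lemma class_C_parint i m n psi : deg i = 0 -> class_C deg m box psi ->
  class_C deg m box (parint a i n psi).
Proof.
move=> di; elim: m n psi => [|m IH] n psi; first exact: parint_cont.
move=> /[dup] -[cpsi H] psi1; split; first exact: parint_cont.
have {}psi1 : class_C deg 1 box psi.
  split=> // j dj; have [dpsi /class_C_cont cdpsi] := H j dj; by split.
move=> j dj; have D y : box y -> _ := @parint_derive _ _ _ a r i di n psi y j dj psi1.
split=> [y By|]; first by have ? := D y By; exact: ex_derive.
apply: (class_C_eq (box_slice_open (a:=a) (r:=r)) _ (IH (n + (j == i))%N _ (H j dj).2)).
by move=> y By; have ? := D y By; rewrite pderivE derive_val.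
Qed.

(** Freezing the coordinate [i] kills the derivative in that direction and
    commutes with the others. *)
Lemma class_C_freeze i m f : deg i = 0 -> 0 < r -> class_C deg m box f ->
  class_C deg m box (fun y => f (upd y i (a i))).
Proof.
move=> di r0; have Bi y : box y -> box (upd y i (a i)).
  by move=> By; apply: box_upd => //; rewrite subrr normr0.
have C f' : cont_on box f' -> cont_on box (fun y => f' (upd y i (a i))).
  move=> fB y By e e0; have [d d0 Hd] := fB _ (Bi y By) e e0; exists d => //.
  move=> z Bz yz; apply: Hd; first exact: Bi.
  by move=> k; rewrite /upd; case: eqP => _; rewrite ?subrr ?normr0.
elim: m f => [|m IH] f; first exact: C.
move=> [fB H]; split; first exact: C.
move=> j dj; have [fd fH] := H j dj.
have [ji|ji] := eqVneq j i.
  have E y : slice (fun y => f (upd y i (a i))) y j = cst (f (upd y i (a i))).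
    by apply/funext => t; rewrite /slice ji -/(upd y i t) upd_upd.
  split=> [y By|]; first by rewrite E; exact: derivable_cst.
  rewrite (_ : pderiv j _ = fun=> 0); first exact: class_C_cst.
  by apply/funext => y; rewrite pderivE E derive_cst.
have E y : slice (fun y => f (upd y i (a i))) y j = slice f (upd y i (a i)) j.
  by apply/funext => t; rewrite /slice -!/(upd _ j t) upd_comm.
have Ej y : upd y i (a i) j = y j by rewrite /upd (negbTE ji).
split=> [y By|]; first by rewrite E -Ej; apply: fd; exact: Bi.
rewrite (_ : pderiv j _ = fun y => pderiv j f (upd y i (a i))); first exact: IH.
by apply/funext => y; rewrite !pderivE E Ej.
Qed.

(** Hadamard's lemma in a single direction: the quotient is the integral of the
    partial derivative along the segment. Treating one coordinate at a time
    avoids the chain rule in several variables. *)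
Lemma hadamard_coord i f : deg i = 0 -> 0 < r -> smooth deg box f ->
  exists q, [/\ smooth deg box q, smooth deg box (fun y => f (upd y i (a i))) &
    forall y, box y -> f y = f (upd y i (a i)) + (y i - a i) * q y].
Proof.
move=> di r0 /smoothP fB; exists (parint a i 0 (pderiv i f)); split.
- apply/smoothP => m; apply: class_C_parint => //.
  by have [_ /(_ i di) []] := fB m.+1.
- by apply/smoothP => m; exact: class_C_freeze.
move=> y By; have [_ /(_ i di) [fd fc]] := fB 1%N; rewrite /= in fc.
pose g (t : R) := f (seg a i t y).
have gd (t : R) : 0 <= t <= 1 -> is_derive t 1 g ((y i - a i) * pderiv i f (seg a i t y)).
  move=> t01; have D1 := @DeriveDef _ _ _ _ _ _ _ (fd _ (box_seg di t01 By)) erefl.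
  move: D1; rewrite -pderivE {1 2}/seg upd_same slice_upd => D1.
  have D2 : is_derive t 1 (fun t' => a i + t' * (y i - a i)) (y i - a i).
    apply: is_derive_eq.
    by rewrite /GRing.scale/=; ring.
  have D3 := @is_derive1_comp R (slice f y i) (fun t' => a i + t' * (y i - a i)) _ _ _ D1 D2.
  by rewrite mulrC.
pose g' (t : R) := (y i - a i) * integrand a i 0 (pderiv i f) y t.
have ci := integrand_continuous di (n := 0) fc By.
have cg' : {within `[0, 1], continuous g'}.
  by move=> t; apply: cvgM; [exact: cvg_cst | exact: ci].
have cg : {within `[(0:R), 1], continuous g}.
  apply: derivable_within_continuous => t t01.
  by have ? := gd t t01; exact: ex_derive.
have LR : derivable_oo_LRcontinuous g 0 1.
  have /(continuous_within_itvP _ (@ltr01 R)) [_ g0 g1] := cg.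
  split=> // t; rewrite in_itv/= => /andP[t0 t1].
  by have ? := gd t ltac:(by rewrite !ltW); exact: ex_derive.
have gg' : {in `]0, 1[, derive1 g =1 g'}.
  move=> t; rewrite in_itv/= => /andP[t0 t1].
  have ? := gd t ltac:(by rewrite !ltW).
  by rewrite derive1E derive_val /g' /integrand expr0 mul1r.
have := continuous_FTC2 ltr01 cg' LR gg'.
move=> /(congr1 fine) /=; rewrite -[LHS]/(\int[lebesgue_measure]_(t in `[0, 1]) g' t).
rewrite RintegralZl; [|exact: measurable_itv|]. 2: by apply: integrand_integrable fc By.
rewrite /g /seg mul0r addr0 mul1r subrKC upd_id => ->.
by rewrite subrKC.
Qed.

End HadamardLemma.

(** * Signs, sections and vector fields *)

Local Notation cst := Defs.cst.

Section Signs.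
Variable A : pzRingType.

Lemma ksignE k : ksign k = (-1) ^+ odd `|k|%N :> A.
Proof. by rewrite /ksign signr_odd. Qed.

Lemma odd_absD (k l : int) : odd `|(k + l)%R|%N = odd `|k|%N (+) odd `|l|%N.
Proof. lia. Qed.

Lemma odd_absM (k l : int) : odd `|(k * l)%R|%N = odd `|k|%N && odd `|l|%N.
Proof. by rewrite abszM oddM. Qed.

Lemma ksignD k l : ksign (k + l) = ksign k * ksign l :> A.
Proof. by rewrite !ksignE odd_absD signr_addb. Qed.

Lemma ksign0 : ksign 0 = 1 :> A.
Proof. by []. Qed.

Lemma ksign_sq k : ksign k * ksign k = 1 :> A.
Proof. by rewrite ksignE -signr_addb addbb. Qed.

Lemma ksignC k (x : A) : x * ksign k = ksign k * x.
Proof. by rewrite ksignE mulr_sign; case: odd; rewrite ?mulrN1 ?mulr1. Qed.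

End Signs.

Section Space.
Variables (R : realType) (X : supermanifold R).
Implicit Types (U V W : set X).

Let ax := sm_axioms X.
Let sh := gs_sheaf ax.

Lemma open_in_refl U : open U -> open_in U U.
Proof. by move=> oU; split. Qed.

Lemma open_in_trans U V W : open_in U V -> open_in V W -> open_in U W.
Proof. by move=> [_ VU] [oW WV]; split=> // p /WV/VU. Qed.

Lemma resB U V (f g : fn X U) : open U -> open_in U V ->
  res U V (f - g) = res U V f - res U V g.
Proof. by move=> oU UV; exact: (sh_resB sh). Qed.

Lemma res_id U (f : fn X U) : open U -> res U U f = f.
Proof. by move=> oU; exact: (sh_res_id sh). Qed.

Lemma res_comp U V W (f : fn X U) : open U -> open_in U V -> open_in V W ->
  res V W (res U V f) = res U W f.
Proof. by move=> *; exact: (sh_res_comp sh). Qed.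

Section Res.
Variables (U V : set X) (oU : open U) (UV : open_in U V).
Implicit Types f g : fn X U.

Lemma res0 : res U V (0 : fn X U) = 0.
Proof. by rewrite -(subrr 0) resB// subrr. Qed.

Lemma resN f : res U V (- f) = - res U V f.
Proof. by rewrite -sub0r resB// res0 sub0r. Qed.

Lemma resD f g : res U V (f + g) = res U V f + res U V g.
Proof. by rewrite -[g in LHS]opprK resB// resN opprK. Qed.

Lemma res_sum (J : Type) (r : seq J) (P : pred J) (F : J -> fn X U) :
  res U V (\sum_(j <- r | P j) F j) = \sum_(j <- r | P j) res U V (F j).
Proof. by apply: big_morph; [exact: resD | exact: res0]. Qed.

Lemma resM f g : res U V (f * g) = res U V f * res U V g.
Proof. exact: gs_resM. Qed.

Lemma res1 : res U V (1 : fn X U) = 1.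
Proof. exact: gs_res1. Qed.

Lemma res_ksign k f : res U V (ksign k * f) = ksign k * res U V f.
Proof. by rewrite !ksignE !mulr_sign; case: odd => //; rewrite resN. Qed.

Lemma res_cst c : res U V (cst U c : fn X U) = cst V c.
Proof. exact: gs_res_cst. Qed.

Lemma resX f n : res U V (f ^+ n) = res U V f ^+ n.
Proof. by elim: n => [|n IH]; rewrite ?expr0 ?res1// !exprS resM IH. Qed.

Lemma res_prod (J : Type) (r : seq J) (F : J -> fn X U) :
  res U V (\prod_(j <- r) F j) = \prod_(j <- r) res U V (F j).
Proof. by apply: big_morph; [exact: resM | exact: res1]. Qed.

End Res.

Lemma fn_eq0 U (s : fn X U) : open U ->
  (forall p, U p -> exists W, [/\ open_in U W, W p & res U W s = 0]) -> s = 0.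
Proof. by move=> oU; exact: (sh_separated sh). Qed.

Lemma hdeg_cst U c : open U -> hdeg 0 (cst U c : fn X U).
Proof. exact: gs_hdeg_cst. Qed.

Lemma hdeg1 U : open U -> hdeg 0 (1 : fn X U).
Proof. by move=> oU; rewrite -(rmorph1 (cst U)); exact: hdeg_cst. Qed.

Lemma hdegM U k l (f g : fn X U) : open U ->
  hdeg k f -> hdeg l g -> hdeg (k + l) (f * g).
Proof. exact: gs_hdegM. Qed.

Lemma hdeg0 U k : open U -> hdeg k (0 : fn X U).
Proof. by move=> oU; exact: (sh_hom0 sh). Qed.

Lemma hdegB U k (f g : fn X U) : open U -> hdeg k f -> hdeg k g -> hdeg k (f - g).
Proof. by move=> oU; exact: (sh_homB sh). Qed.

Lemma hdegN U k (f : fn X U) : open U -> hdeg k f -> hdeg k (- f).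
Proof. by move=> oU fk; rewrite -sub0r; apply: hdegB => //; exact: hdeg0. Qed.

Lemma hdegD U k (f g : fn X U) : open U -> hdeg k f -> hdeg k g -> hdeg k (f + g).
Proof. by move=> oU fk gk; rewrite -[g]opprK; apply: hdegB => //; exact: hdegN. Qed.

Lemma hdeg_ksign U k l (f : fn X U) : open U -> hdeg k f -> hdeg k (ksign l * f).
Proof.
by move=> oU fk; rewrite ksignE mulr_sign; case: odd => //; exact: hdegN.
Qed.

Lemma hdeg_res U V k (f : fn X U) : open U -> open_in U V ->
  hdeg k f -> hdeg k (res U V f).
Proof. by move=> oU; exact: (sh_hom_res sh). Qed.

Section VField.
Variables (V : set X) (k : int) (D : operator X) (DV : vfield V k D).

Section OnOpen.
Variables (U : set X) (VU : open_in V U).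
Implicit Types f g : fn X U.

Lemma vf0 : D (0 : fn X U) = 0.
Proof. by rewrite -[X in D X](subrr 0) (vfB DV)// subrr. Qed.

Lemma vfN f : D (- f) = - D f.
Proof. by rewrite -sub0r (vfB DV)// vf0 sub0r. Qed.

Lemma vfD f g : D (f + g) = D f + D g.
Proof. by rewrite -[g in LHS]opprK (vfB DV)// vfN opprK. Qed.

Lemma vf_sum (J : Type) (r : seq J) (P : pred J) (F : J -> fn X U) :
  D (\sum_(j <- r | P j) F j) = \sum_(j <- r | P j) D (F j).
Proof. by apply: big_morph; [exact: vfD | exact: vf0]. Qed.

Lemma vf_ksign l f : D (ksign l * f) = ksign l * D f.
Proof. by rewrite !ksignE !mulr_sign; case: odd => //; exact: vfN. Qed.

Lemma vf_cstM c f : D (cst U c * f) = cst U c * D f.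
Proof.
have oU : open U by case: VU.
rewrite (vf_leibniz DV _ VU (hdeg_cst c oU)) mulr0 ksign0 mul1r.
by rewrite (vf_cst DV)// mul0r add0r.
Qed.

End OnOpen.

Lemma vfieldW W : open_in V W -> vfield W k D.
Proof.
move=> VW; have T U : open_in W U -> open_in V U by exact: open_in_trans.
split; first by case: VW.
- by move=> U f g /T VU; exact: (vfB DV).
- by move=> U c /T VU; exact: (vf_cst DV).
- by move=> U U' f /T VU; exact: (vf_res DV).
- by move=> U l f /T VU; exact: (vf_deg DV).
- by move=> U l f g /T VU; exact: (vf_leibniz DV).
Qed.

End VField.

Lemma vfield_sub V k (D D' : operator X) : vfield V k D -> vfield V k D' ->
  vfield V k (fun U f => D U f - D' U f).
Proof.
move=> DV DV'; split; first exact: vf_open DV.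
- by move=> U f g VU; rewrite (vfB DV)// (vfB DV')// !opprD addrACA.
- by move=> U c VU; rewrite (vf_cst DV)// (vf_cst DV')// subrr.
- move=> U W f VU UW; rewrite resB ?(vf_res DV)// ?(vf_res DV')//.
  by case: VU.
- move=> U l f VU fl; apply: hdegB; first by case: VU.
    exact: (vf_deg DV).
  exact: (vf_deg DV').
- move=> U l f g VU fl.
  rewrite (vf_leibniz DV _ VU fl) (vf_leibniz DV' _ VU fl).
  by rewrite mulrBl mulrBr mulrBr opprD addrACA.
Qed.

(** In the Leibniz rule for a commutator the cross terms D'f Dg and Df D'g occur
    twice, with signs that make them cancel. *)
Lemma gcommutator_vfield V k l (D D' : operator X) :
  vfield V k D -> vfield V l D' -> vfield V (k + l) (gcommutator k l D D').
Proof.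
move=> DV DV'; split; first exact: vf_open DV.
- move=> U f g VU; rewrite /gcommutator (vfB DV')// !(vfB DV)// (vfB DV')//.
  by rewrite mulrBr !opprD addrACA.
- move=> U c VU; rewrite /gcommutator (vf_cst DV)// (vf_cst DV')//.
  by rewrite (vf0 DV)// (vf0 DV')// mulr0 subrr.
- move=> U W f VU UW; have oU : open U by case: VU.
  by rewrite /gcommutator resB// res_ksign// !(vf_res DV, vf_res DV').
- move=> U m f VU fm; have oU : open U by case: VU.
  rewrite /gcommutator; apply: hdegB => //.
    by rewrite -addrA; apply: (vf_deg DV) => //; exact: (vf_deg DV').
  apply: hdeg_ksign => //; rewrite (addrC k) -addrA.
  by apply: (vf_deg DV') => //; exact: (vf_deg DV).
move=> U m f g VU fm; have oU : open U by case: VU.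
have Df := vf_deg DV VU fm; have D'f := vf_deg DV' VU fm.
rewrite /gcommutator (vf_leibniz DV _ VU fm) (vf_leibniz DV' _ VU fm).
rewrite (vfD DV)// (vfD DV')// !(vf_ksign DV)// !(vf_ksign DV')//.
rewrite (vf_leibniz DV _ VU D'f) (vf_leibniz DV _ VU fm).
rewrite (vf_leibniz DV' _ VU Df) (vf_leibniz DV' _ VU fm).
have cancel (a p q t s w : fn X U) :
    a + p + (q + t) - (s + q + (p + w)) = (a - s) + (t - w).
  have -> : a + p + (q + t) = (a + t) + (p + q) by rewrite (addrC q t) addrACA.
  have -> : s + q + (p + w) = (s + w) + (p + q).
    by rewrite (addrC p w) addrACA (addrC q p).
  by rewrite [- (s + w + _)]opprD [LHS]addrACA subrr addr0 opprD addrACA.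
rewrite !mulrDr !mulrA -!ksignD.
have -> : ksign (k * l + (l * k + l * m)) = ksign (l * m) :> fn X U.
  by rewrite addrA ksignD (mulrC l k) ksignD ksign_sq mul1r.
rewrite cancel mulrBl; congr (_ - _ + _).
have -> : (k + l) * m = l * m + k * m by ring.
rewrite mulrN -[RHS]/(_ - _); congr (_ - _).
rewrite -!mulrA [f * (ksign _ * _)]mulrA ksignC -mulrA !mulrA -!ksignD.
by congr (ksign _ * _ * _); ring.
Qed.

End Space.

(** * Vector fields and coordinates *)

(** Sums over lists with repetitions become sums with multiplicities over any
    duplicate-free list containing them; in characteristic 0 this is enough to
    compare two expansions whose exponent lists are unrelated. *)
Lemma sum_mulrn_count (T : eqType) (G : zmodType) (F : T -> G) (es u : seq T) :
  uniq u -> {subset es <= u} ->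
  \sum_(e <- u) F e *+ count_mem e es = \sum_(e <- es) F e.
Proof.
move=> uu; elim: es => [_|x es IH sub].
  by rewrite big_nil big1_seq.
rewrite big_cons -IH; last by move=> e ees; apply: sub; rewrite inE ees orbT.
under eq_bigr do rewrite /= mulrnDr.
rewrite big_split /=; congr (_ + _).
have xu : x \in u by apply: sub; rewrite inE eqxx.
rewrite (bigD1_seq x)//= eqxx big1 ?addr0// => e ex.
by rewrite eq_sym (negbTE ex).
Qed.

Lemma open_body_slice_open (R : realType) (I : finType) (deg : I -> int)
  (U : set {ptws I -> R}) : open_body deg U -> slice_open deg U.
Proof.
move=> [G oG ->] y i [Gy yb] di.
have /nbhs_near_ptP[r r0 rG] : nbhs y G by exact: open_nbhs_nbhs.
apply: filterS (nbhsx_ballx (y i) r r0) => t; rewrite /ball/= distrC => ty.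
split; first by apply: rG; apply: near_pt_upd => //; exact: near_pt_refl.
move=> j dj; rewrite /upd; case: eqP => [ji|_]; last exact: yb.
by rewrite ji di in dj.
Qed.

Section Chart.
Variables (R : realType) (X : supermanifold R) (V : set X) (I : finType).
Variables (deg : I -> int) (x : I -> fn X V) (kap : X -> (I -> R)).
Variable (ev : forall U : set X, ((I -> R) -> R) -> fn X U).
Arguments ev : clear implicits.
Hypothesis C : chart_on deg x kap ev.

Lemma chart_restrict W : open_in V W ->
  chart_on deg (fun i => res V W (x i)) kap ev.
Proof.
move=> VW; have [oW WV] := VW; have oV := ch_open C.
have T U : open_in W U -> open_in V U by exact: open_in_trans.
have monoE U e : open_in W U -> mono U (fun i => res V W (x i)) e = mono U x e.
  by move=> WU; apply: eq_bigr => i _; rewrite res_comp.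
split=> //.
- by move=> i; apply: hdeg_res => //; exact: (ch_deg C).
- by apply: continuous_subspaceW WV _; exact: (ch_cont C).
- by move=> p q pW qW; apply: (ch_inj C); rewrite inE; apply: WV; rewrite -inE.
- by move=> U /T; exact: (ch_img C).
- by move=> U f g /T; exact: (ch_ev_ext C).
- by move=> U f /T; exact: (ch_ev_deg C).
- by move=> U f g /T; exact: (ch_evD C).
- by move=> U f g /T; exact: (ch_evM C).
- by move=> U c /T; exact: (ch_ev_cst C).
- by move=> U i WU di; rewrite res_comp//; apply: (ch_ev_coord C) => //; exact: T.
- by move=> U U' f /T; exact: (ch_ev_res C).
- move=> U F p WU Up; have [U' [es [f [UU' U'p ees fs E]]]] := ch_span C F (T _ WU) Up.
  exists U', es, f; split=> //; rewrite E; apply: eq_bigr => e _.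
  by rewrite monoE//; exact: open_in_trans UU'.
- move=> U es f WU ues ees fs E; apply: (ch_free C) => //; first exact: T.
  by rewrite -[RHS]E; apply: eq_bigr => e _; rewrite monoE.
Qed.

(** Boxes are needed because Hadamard's lemma integrates along segments. *)
Lemma chart_box U p : open_in V U -> U p -> exists r W,
  [/\ 0 < r, open_in U W, W p & kap @` W = box deg (kap p) r].
Proof.
move=> VU Up; have [oU UV] := VU; have [G oG GE] := ch_img C VU.
have Gp : (G `&` body_space deg) (kap p) by rewrite -GE; exists p.
have /nbhs_near_ptP[r r0 rG] : nbhs (kap p : {ptws I -> R}) G.
  by apply: open_nbhs_nbhs; split => //; case: Gp.
pose W := U `&` (V `&` kap @^-1` (near_pt (kap p) r)).
exists r, W; split=> //.
- split; last by move=> q [].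
  have oV := ch_open C; have := ch_cont C.
  rewrite continuous_open_subspace// => kc; apply: openI => //.
  exact: (@continuous_inP _ _ V (kap : X -> {ptws I -> R}) oV).1 kc _ (open_near_pt _ _).
- by split=> //; split; [exact: UV | exact: near_pt_refl].
apply/seteqP; split=> y.
  move=> [q [Uq [_ qp]] <-]; split=> //.
  have : (G `&` body_space deg) (kap q) by rewrite -GE; exists q.
  by case.
move=> [yb yp]; have : (kap @` U) y by rewrite GE; split=> //; exact: rG.
by move=> [q Uq qy]; exists q => //; split=> //; split; [exact: UV | rewrite /= qy].
Qed.

(** Freeness of the monomials identifies coefficients as functions; it is used
    at a single point, where multiplication by a coordinate difference has
    annihilated one side. *)
Lemma ch_free_at U (es es' : seq {ffun I -> nat})
    (h g : {ffun I -> nat} -> (I -> R) -> R) :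
  open_in V U -> all (expo deg) es -> all (expo deg) es' ->
  (forall e, smooth deg (kap @` U) (h e)) ->
  (forall e, smooth deg (kap @` U) (g e)) ->
  \sum_(e <- es) ev U (h e) * mono U x e =
    \sum_(e <- es') ev U (g e) * mono U x e ->
  forall a, (kap @` U) a -> (forall e, g e a = 0) ->
  forall e, e \in es -> h e a = 0.
Proof.
move=> VU ees ees' hs gs E a Ua g0 e ein.
pose u := undup (es ++ es').
pose k e y := (count_mem e es)%:R * h e y + - (count_mem e es')%:R * g e y.
have so := open_body_slice_open (ch_img C VU).
have sm c f : smooth deg (kap @` U) f -> smooth deg (kap @` U) (fun y => c * f y).
  by move=> fs; exact: (smoothM so (smooth_cst _ c) fs).
have evc c f : smooth deg (kap @` U) f -> ev U (fun y => c * f y) = cst U c * ev U f.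
  by move=> fs; rewrite (ch_evM C VU (smooth_cst _ c) fs) (ch_ev_cst C _ VU).
have : {in kap @` U, k e =1 fun=> 0}.
  apply: (ch_free C VU (es := u)).
  - exact: undup_uniq.
  - apply/allP => e'; rewrite mem_undup mem_cat.
    by move=> /orP[/(allP ees)|/(allP ees')].
  - by move=> e'; apply: smoothD => //; exact: sm.
  - have -> : \sum_(e <- u) ev U (k e) * mono U x e =
       \sum_(e <- u) ((ev U (h e) * mono U x e) *+ count_mem e es) -
       \sum_(e <- u) ((ev U (g e) * mono U x e) *+ count_mem e es').
      rewrite -sumrB; apply: eq_bigr => e' _.
      rewrite (ch_evD C) ?evc//; try exact: sm.
      by rewrite mulrDl rmorphN !rmorph_nat !mulNr -!mulrA !mulr_natl.
    rewrite !sum_mulrn_count ?undup_uniq ?E ?subrr// => e'.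
      by rewrite mem_undup mem_cat => ->; rewrite orbT.
    by rewrite mem_undup mem_cat => ->.
  - by rewrite mem_undup mem_cat ein.
move=> /(_ a); rewrite inE => /(_ Ua); rewrite /k g0 mulr0 addr0 => /eqP.
rewrite mulf_eq0 pnatr_eq0 => /orP[/eqP c0|/eqP//].
by move: ein; rewrite -has_pred1 has_count c0.
Qed.

Section Killing.
Variables (k : int) (D : operator X).
Hypotheses (DV : vfield V k D) (Dx : forall i, D (x i) = 0).

Let oV : open V := ch_open C.

Lemma vfield_res_coord W i : open_in V W -> D (res V W (x i)) = 0.
Proof.
move=> VW; rewrite -(vf_res DV) ?Dx ?res0//; exact: open_in_refl.
Qed.

Lemma vfield_mono_eq0 W e : open_in V W -> D (mono W x e) = 0.
Proof.
move=> VW; have oW : open W by case: VW.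
pose killed (f : fn X W) := (exists l, hdeg l f) /\ D f = 0.
have K1 : killed 1.
  split; first by exists 0; exact: hdeg1.
  by rewrite -(rmorph1 (cst W)) (vf_cst DV).
have KM f g : killed f -> killed g -> killed (f * g).
  move=> [[l fl] f0] [[m gm] g0]; split; first by exists (l + m); exact: hdegM.
  by rewrite (vf_leibniz DV _ VW fl) f0 g0 mul0r !mulr0 addr0.
suff: killed (mono W x e) by case.
apply: (big_ind killed) => // i _.
elim: (e i) => [|n IH]; first by rewrite expr0.
rewrite exprS; apply: KM => //; split; last exact: vfield_res_coord.
by exists (deg i); apply: hdeg_res => //; exact: (ch_deg C).
Qed.

(** A derivation killing the coordinates kills smooth functions of them, by
    induction on the set [s] of coordinates that the function involves. Near a
    point [a], Hadamard's lemma splits [f] into a function not involving [i],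
    killed by induction, and [(y i - a i) * q]. The derivation sends the latter
    to [(x i - a i)] times the derivative of [q], whose coefficients vanish at
    [a]; as [a] is arbitrary, all coefficients of the derivative of [f] vanish. *)
Lemma vfield_ev_eq0 (s : seq I) W f : open_in V W -> smooth deg (kap @` W) f ->
  (forall y z, (kap @` W) y -> (kap @` W) z -> {in s, y =1 z} -> f y = f z) ->
  D (ev W f) = 0.
Proof.
elim: s W f => [|i s IH] W f VW fs fdep; have [oW WV] := VW.
  apply: fn_eq0 => // p Wp; exists W; split=> //; first exact: open_in_refl.
  rewrite (@ch_ev_ext _ _ _ _ _ _ _ _ C W f (fun=> f (kap p))) //.
    by rewrite (ch_ev_cst C)// (vf_cst DV)// res0//; exact: open_in_refl.
  by move=> y; rewrite inE => Wy; apply: fdep => //; exists p.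
have [G _ GE] := ch_img C VW.
(* A coordinate of nonzero degree vanishes on the body. *)
have [di|di] := eqVneq (deg i) 0; last first.
  apply: (IH W f) => // y z Wy Wz yz; apply: fdep => // j.
  rewrite inE => /orP[/eqP->|/yz//].
  move: Wy Wz; rewrite GE => -[_ yb] [_ zb].
  by rewrite yb// zb.
have evD U : open_in W U -> res W U (D (ev W f)) = D (ev U f).
  by move=> WU; rewrite (vf_res DV)// (ch_ev_res C).
apply: fn_eq0 => // p Wp.
have [W1 [es [h [WW1 W1p ees hs E]]]] := ch_span C (D (ev W f)) VW Wp.
exists W1; split=> //; rewrite E; have VW1 := open_in_trans VW WW1.
rewrite big1_seq // => e /andP[_ ein].
rewrite (@ch_ev_ext _ _ _ _ _ _ _ _ C W1 (h e) (fun=> 0))//; last first.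
  move=> y; rewrite inE => -[q W1q <-{y}].
  have [r [W2 [r0 W12 W2q kW2]]] := chart_box VW1 W1q.
  have VW2 := open_in_trans VW1 W12; have WW2 := open_in_trans WW1 W12.
  set a := kap q in kW2 *.
  have fbox : smooth deg (box deg a r) f.
    by apply: smoothW fs; rewrite -kW2; apply: image_subset; case: WW2.
  have [g [gs f0s fE]] := hadamard_coord di r0 fbox.
  rewrite -kW2 in gs f0s.
  have D0 : D (ev W2 (fun y => f (upd y i (a i)))) = 0.
    apply: (IH W2) => // y z; rewrite kW2 => By Bz yz.
    have subW : box deg a r `<=` kap @` W.
      by rewrite -kW2; apply: image_subset; case: WW2.
    apply: fdep; try (apply: subW; apply: box_upd => //; by rewrite subrr normr0).
    by move=> j; rewrite inE /upd; case: eqP => //= _; exact: yz.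
  have lin : smooth deg (kap @` W2) (fun y => y i + (- a i)).
    have so := open_body_slice_open (ch_img C VW2).
    exact: (smoothD so (smooth_coord _ i) (smooth_cst _ (- a i))).
  have evlin : D (ev W2 (fun y => y i + - a i)) = 0.
    rewrite (ch_evD C VW2 (smooth_coord _ i) (smooth_cst _ (- a i))).
    rewrite (vfD DV)// (ch_ev_cst C)// (vf_cst DV)// (ch_ev_coord C)//.
    by rewrite vfield_res_coord// addr0.
  have evf : D (ev W2 f) = ev W2 (fun y => y i + - a i) * D (ev W2 g).
    rewrite (@ch_ev_ext _ _ _ _ _ _ _ _ C W2 f
      (fun y => f (upd y i (a i)) + (y i + - a i) * g y))//; last first.
      by move=> y; rewrite inE kW2 => By; exact: fE.
    have so := open_body_slice_open (ch_img C VW2).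
    rewrite (ch_evD C VW2 f0s (smoothM so lin gs)) (ch_evM C VW2 lin gs).
    rewrite (vfD DV)// D0 add0r.
    rewrite (vf_leibniz DV _ VW2 (ch_ev_deg C VW2 lin)) evlin mul0r add0r.
    by rewrite mulr0 ksign0 mul1r.
  have [W3 [es' [h' [W23 W3q ees' hs' E']]]] := ch_span C (D (ev W2 g)) VW2 W2q.
  have VW3 := open_in_trans VW2 W23; have [oW2 _] := VW2.
  have sub3 : kap @` W3 `<=` kap @` W2 by apply: image_subset; case: W23.
  have sub13 : kap @` W3 `<=` kap @` W1.
    by apply: subset_trans sub3 _; apply: image_subset; case: W12.
  have lin3 := smoothW sub3 lin.
  have so3 := open_body_slice_open (ch_img C VW3).
  refine (@ch_free_at W3 es es' h (fun e y => (y i + - a i) * h' e y)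
    VW3 ees ees' _ _ _ a _ _ e ein).
  - by move=> e'; exact: smoothW (hs e').
  - by move=> e'; exact: smoothM so3 lin3 (hs' e').
  - have oW1 : open W1 by case: VW1.
    have W13 := open_in_trans W12 W23.
    have -> : \sum_(e0 <- es) ev W3 (h e0) * mono W3 x e0 =
              res W1 W3 (\sum_(e0 <- es) ev W1 (h e0) * mono W1 x e0).
      rewrite res_sum//; apply: eq_bigr => e' _; rewrite resM// (ch_ev_res C)//.
      congr (_ * _); rewrite /mono res_prod//; apply: eq_bigr => j _.
      by rewrite resX// res_comp.
    rewrite -E res_comp// -(res_comp _ oW WW2 W23) evD// evf resM// E' mulr_sumr.
    apply: eq_bigr => e' _; rewrite mulrA (ch_evM C VW3 lin3 (hs' e')).
    by rewrite (ch_ev_res C VW2 W23 lin).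
  - by exists q.
  - by move=> e'; rewrite subrr mul0r.
by rewrite (ch_ev_cst C)// rmorph0 mul0r.
Qed.

End Killing.

(** Writing a section as a polynomial with smooth coefficients, only the
    coefficients are left to be differentiated. *)
Lemma vfield_eq0 k (D : operator X) : vfield V k D -> (forall i, D V (x i) = 0) ->
  forall U F, open_in V U -> D U F = 0.
Proof.
move=> DV Dx U F VU; have oU : open U by case: VU.
apply: fn_eq0 => // p Up.
have [W [es [f [UW Wp ees fs E]]]] := ch_span C F VU Up.
have VW := open_in_trans VU UW; have oW : open W by case: VW.
exists W; split=> //; rewrite (vf_res DV)// E (vf_sum DV)// big1_seq// => e _.
rewrite (vf_leibniz DV _ VW (ch_ev_deg C VW (fs e))) (vfield_mono_eq0 DV Dx)//.
rewrite (vfield_ev_eq0 DV Dx (s := enum I))// ?mul0r ?mulr0 ?addr0//.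
by move=> y z _ _ yz; congr (f e _); apply/funext => i; apply: yz; rewrite mem_enum.
Qed.

Lemma vfield_unique k (D D' : operator X) : vfield V k D -> vfield V k D' ->
  (forall i, D V (x i) = D' V (x i)) ->
  forall U F, open_in V U -> D U F = D' U F.
Proof.
move=> DV DV' DD' U F VU; apply/eqP; rewrite -subr_eq0; apply/eqP.
apply: (vfield_eq0 (vfield_sub DV DV') _ F VU) => i.
by rewrite DD' subrr.
Qed.

End Chart.

(** * Pullbacks, frames and homogeneous coefficients *)

Section Pull.
Variables (R : realType) (N M : supermanifold R) (pi : smap N M).
Implicit Types U V : set M.

Lemma open_pre U : open U -> open (pi @^-1` U).
Proof. by move=> oU; have /continuousP := @sm_cont _ _ _ pi; apply. Qed.

Lemma open_in_pre U V : open_in U V -> open_in (pi @^-1` U) (pi @^-1` V).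
Proof. by move=> [oV VU]; split; [exact: open_pre | move=> q /VU]. Qed.

Section OnOpen.
Variables (U : set M) (oU : open U).
Implicit Types f g : fn M U.

Lemma pull0 : pull pi (0 : fn M U) = 0.
Proof. by rewrite -[X in pull pi X](subrr 0) pullB// subrr. Qed.

Lemma pullN f : pull pi (- f) = - pull pi f.
Proof. by rewrite -sub0r pullB// pull0 sub0r. Qed.

Lemma pullD f g : pull pi (f + g) = pull pi f + pull pi g.
Proof. by rewrite -[g in LHS]opprK pullB// pullN opprK. Qed.

Lemma pull_sum (J : Type) (r : seq J) (P : pred J) (F : J -> fn M U) :
  pull pi (\sum_(j <- r | P j) F j) = \sum_(j <- r | P j) pull pi (F j).
Proof. by apply: big_morph; [exact: pullD | exact: pull0]. Qed.

Lemma pull_ksign k f : pull pi (ksign k * f) = ksign k * pull pi f.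
Proof. by rewrite !ksignE !mulr_sign; case: odd => //; exact: pullN. Qed.

End OnOpen.
End Pull.

Section Sections.
Variables (R : realType) (M : supermanifold R) (E : vbundle M).
Implicit Types (U V W : set M).

Let sh := vb_sheaf E.

Lemma sres_id U (s : sect E U) : open U -> sres U U s = s.
Proof. by move=> oU; exact: (sh_res_id sh). Qed.

Lemma sres_comp U V W (s : sect E U) : open U -> open_in U V -> open_in V W ->
  sres V W (sres U V s) = sres U W s.
Proof. by move=> *; exact: (sh_res_comp sh). Qed.

Lemma sdeg_res U V k (s : sect E U) : open U -> open_in U V ->
  sdeg k s -> sdeg k (sres U V s).
Proof. by move=> oU; exact: (sh_hom_res sh). Qed.

Section OnOpen.
Variables (U : set M) (oU : open U).
Implicit Types s t : sect E U.

Lemma sdeg0 k : sdeg k (0 : sect E U).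
Proof. exact: (sh_hom0 sh). Qed.

Lemma sdegB k s t : sdeg k s -> sdeg k t -> sdeg k (s - t).
Proof. exact: (sh_homB sh). Qed.

Lemma sdegN k s : sdeg k s -> sdeg k (- s).
Proof. by move=> sk; rewrite -sub0r; apply: sdegB => //; exact: sdeg0. Qed.

Lemma sdegD k s t : sdeg k s -> sdeg k t -> sdeg k (s + t).
Proof. by move=> sk tk; rewrite -[t]opprK; apply: sdegB => //; exact: sdegN. Qed.

End OnOpen.

(** Charts and frames are found on different neighbourhoods of a point; both
    have to be cut down to a common one. *)
Lemma frame_restrict V W (A : finType) (p : A -> int) (X : A -> sect E V) :
  open_in V W -> frame p X -> frame p (fun a => sres V W (X a)).
Proof.
move=> VW fr; have [oW WV] := VW; have oV := fr_open fr.
split=> // [a|U s WU]; first by apply: sdeg_res => //; exact: (fr_deg fr).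
have [g [gs gu]] := fr_basis fr s (open_in_trans VW WU).
have H (h : A -> fn M U) : \sum_a h a *: sres W U (sres V W (X a)) =
    \sum_a h a *: sres V U (X a).
  by apply: eq_bigr => a _; rewrite sres_comp.
by exists g; split; [rewrite H | move=> h; rewrite H; exact: gu].
Qed.

Lemma hdegMn U k (f : fn M U) n : open U -> hdeg k f -> hdeg k (f *+ n).
Proof.
move=> oU fk; elim: n => [|n IH]; first by rewrite mulr0n; exact: hdeg0.
by rewrite mulrS; exact: hdegD.
Qed.

(** Regroup the homogeneous components of the coefficients by total degree:
    only the part of total degree [k] survives. *)
Lemma homogeneous_coefficients V (A : finType) (p : A -> int)
    (X : A -> sect E V) k (s : sect E V) : frame p X -> sdeg k s ->
  exists g : A -> fn M V, (forall a, hdeg (k - p a) (g a)) /\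
    s = \sum_a g a *: X a.
Proof.
move=> fr sk; have oV := fr_open fr.
have [g [gs' _]] := fr_basis fr s (open_in_refl oV).
have {gs'} gs : s = \sum_a g a *: X a.
  by rewrite {1}gs'; apply: eq_bigr => a _; rewrite sres_id.
have dec a : exists kc : seq int * (int -> fn M V),
    (forall l, hdeg l (kc.2 l)) /\ g a = \sum_(l <- kc.1) kc.2 l.
  have [ks [c [hc gE]]] := sh_decomp (gs_sheaf (sm_axioms M)) (g a) oV.
  by exists (ks, c).
have [kc kcP] := choice dec.
pose c a l := (kc a).2 l *+ count_mem l (kc a).1.
pose T := undup (k :: flatten [seq [seq l + p a | l <- (kc a).1] | a <- enum A]).
have uT : uniq T by exact: undup_uniq.
have kT : k \in T by rewrite mem_undup inE eqxx.
have hc a n : hdeg (n - p a) (c a (n - p a)).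
  by apply: hdegMn => //; exact: (kcP a).1.
have gE a : g a = \sum_(n <- T) c a (n - p a).
  rewrite -(big_map (fun n => n - p a) xpredT (c a)) (kcP a).2.
  rewrite -(sum_mulrn_count _ (u := [seq n - p a | n <- T]))//.
    by rewrite map_inj_uniq// => m n /addIr.
  move=> l la; apply/mapP; exists (l + p a); last by rewrite addrK.
  rewrite mem_undup inE; apply/orP; right; apply/flattenP.
  exists [seq l + p a | l <- (kc a).1]; last exact: map_f.
  by apply/mapP; exists a => //; rewrite mem_enum.
pose S n := \sum_a c a (n - p a) *: X a.
have Sn n : sdeg n (S n).
  apply: big_ind => [|s1 s2|a _]; [exact: sdeg0 | exact: sdegD |].
  by have := vb_degZ oV (hc a n) (fr_deg fr a); rewrite subrK.
have sE : s = \sum_(n <- T) S n.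
  rewrite gs exchange_big; apply: eq_bigr => a _.
  by rewrite gE scaler_suml.
exists (fun a => c a (k - p a)); split=> //.
(* The components of [s] in the degrees other than [k] are zero: the family
   [D] is homogeneous and sums to [s - s]. *)
pose D n := S n - (if n == k then s else 0).
apply/esym/eqP; rewrite -subr_eq0; apply/eqP.
have := @sh_indep _ _ _ _ sh V T D oV uT _ _ k kT; rewrite /D eqxx; apply.
  move=> n; apply: sdegB => //; case: eqP => [->//|_]; exact: sdeg0.
by rewrite sumrB -sE -big_mkcond /= (big_rem k)//= eqxx big1_seq ?addr0 ?subrr// => n
  /andP[/eqP-> ]; rewrite mem_rem_uniqF.
Qed.

End Sections.

(** * Lie derivatives, associated vector fields and lifts *)

Lemma open_inT (T : topologicalType) (U : set T) : open U -> open_in setT U.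
Proof. by move=> oU; split. Qed.

Section LieDerivative.
Variables (R : realType) (N P : supermanifold R) (o : odd_tangent N P).
Variables (V : set N) (k : int) (Y : operator N) (YV : vfield V k Y).

Lemma Lie_vfield : vfield (o @^-1` V) (k - 1 + 1) (Lie o k Y).
Proof.
apply: gcommutator_vfield; first exact: contraction_vfield.
apply: (vfieldW (dR_vfield o)); split=> //.
exact: (open_pre o (vf_open YV)).
Qed.

Lemma Lie_pull U (f : fn N U) : open_in V U ->
  Lie o k Y (pull o f) = pull o (Y f).
Proof.
move=> VU; have oU : open U by case: VU.
rewrite /Lie /gcommutator (contraction_d o f YV VU) (contraction_fn o f YV VU).
rewrite (vf0 (dR_vfield o)) ?mulr0 ?subr0//; apply: open_inT; exact: open_pre.
Qed.

(** Of the two terms of the commutator with d only one is left since d(df) = 0: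
    up to sign, the Lie derivative commutes with d. *)
Lemma Lie_dR_pull U (f : fn N U) : open_in V U ->
  Lie o k Y (dR o (pull o f)) = - (ksign (k - 1) * dR o (pull o (Y f))).
Proof.
move=> VU; have oU : open U by case: VU.
rewrite /Lie /gcommutator (contraction_d o f YV VU) dR_dR// mulr1.
rewrite (vf0 (contraction_vfield o YV)) ?sub0r//; exact: open_in_pre.
Qed.

End LieDerivative.

Section Associated.
Variables (R : realType) (M : supermanifold R) (E : vbundle M).
Variables (b : anchored_bracket E) (N : supermanifold R) (t : total_space 1 E N).
Variables (Q : operator N) (bQ : associated_vfield b t Q).
Variables (V : set M) (I : finType) (deg : I -> int) (x : I -> fn M V).
Variables (A : finType) (p : A -> int) (X : A -> sect E V).
Variable (c : A -> A -> A -> fn M V).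
Hypotheses (chx : chart deg x) (frX : frame p X).
Hypothesis brX : forall a a', bracket b (X a) (X a') = \sum_g c a a' g *: X g.

Let oV : open V := fr_open frX.
Let oT : open (t @^-1` V) := open_pre t oV.

(** Each partial derivative of the coordinate formula sees one coordinate, so on
    a coordinate of the base only the anchor is left, and on a fibre coordinate
    only the bracket. *)
Lemma associated_base i : Q (pull t (x i)) =
  \sum_a tcoord t X a * pull t (anchor b (X a) V (x i)).
Proof.
have [_ /(_ V I deg x A p X c chx frX brX) [partial dp QE]] := bQ.
rewrite QE; last exact: open_in_refl.
rewrite [X in _ - X]big1 => [|a _]; last first.
  rewrite big1// => a' _; rewrite big1// => g _.
  by rewrite ((dp (inr g)).2 (inl i)); rewrite !mulr0.
rewrite subr0; apply: eq_bigr => a _.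
rewrite (bigD1 i)//= big1 => [|j ji].
  by rewrite ((dp (inl i)).2 (inl i)); rewrite eqxx mulr1 addr0 res_id.
rewrite ((dp (inl j)).2 (inl i)).
by rewrite -[inl j == _]/(j == i) (negbTE ji) mulr0.
Qed.

Lemma associated_fibre g : Q (tcoord t X g) =
  - \sum_a \sum_a' ksign (p a * (p a' - 1)) * (cst _ 2^-1 *
       (tcoord t X a * tcoord t X a' * pull t (c a a' g))).
Proof.
have [_ /(_ V I deg x A p X c chx frX brX) [partial dp QE]] := bQ.
rewrite QE; last exact: open_in_refl.
rewrite [X in X - _]big1 => [|a _]; last first.
  by rewrite big1// => i _; rewrite ((dp (inl i)).2 (inr g)); rewrite mulr0.
rewrite sub0r; congr (- _); apply: eq_bigr => a _; apply: eq_bigr => a' _.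
rewrite (bigD1 g)//= big1 => [|j ji].
  by rewrite ((dp (inr g)).2 (inr g)); rewrite eqxx mulr1 addr0 res_id.
rewrite ((dp (inr j)).2 (inr g)).
by rewrite -[inr j == _]/(j == g) (negbTE ji) !mulr0.
Qed.

End Associated.

Section Lifted.
Variables (R : realType) (M : supermanifold R) (E : vbundle M).
Variables (b : anchored_bracket E).
Variables (TM : supermanifold R) (tM : odd_tangent M TM).
Variables (B : vbundle TM) (L : lifts E tM B) (b' : anchored_bracket B).
Hypothesis lb : lifted_bracket b L b'.

Lemma anchorN (M' : supermanifold R) (E' : vbundle M') (d : anchored_bracket E')
    V (X : sect E' V) U f : open V -> open_in V U ->
  anchor d (- X) U f = - anchor d X U f.
Proof.
move=> oV VU; have E0 : anchor d (0 : sect E' V) U f = 0.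
  by rewrite -(subrr X) anchorB// subrr.
by rewrite -sub0r anchorB// E0 sub0r.
Qed.

Lemma bracketNl (M' : supermanifold R) (E' : vbundle M') (d : anchored_bracket E')
    V (X Y : sect E' V) : open V -> bracket d (- X) Y = - bracket d X Y.
Proof.
move=> oV; have := bracketBl d X X Y oV; rewrite !subrr => E0.
by rewrite -sub0r bracketBl// E0 sub0r.
Qed.

Lemma bracketNr (M' : supermanifold R) (E' : vbundle M') (d : anchored_bracket E')
    V (X Y : sect E' V) : open V -> bracket d X (- Y) = - bracket d X Y.
Proof.
move=> oV; have := bracketBr d X Y Y oV; rewrite !subrr => E0.
by rewrite -sub0r bracketBr// E0 sub0r.
Qed.

Section OnOpen.
Variables (V : set M) (oV : open V).
Implicit Types X Y : sect E V.

Lemma clift0 : clift L (0 : sect E V) = 0.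
Proof. by rewrite -[X in clift L X](subrr 0) cliftB// subrr. Qed.

Lemma vlift0 : vlift L (0 : sect E V) = 0.
Proof. by rewrite -[X in vlift L X](subrr 0) vliftB// subrr. Qed.

Lemma vliftN X : vlift L (- X) = - vlift L X.
Proof. by rewrite -sub0r vliftB// vlift0 sub0r. Qed.

Lemma cliftD X Y : clift L (X + Y) = clift L X + clift L Y.
Proof.
have N (Z : sect E V) : clift L (- Z) = - clift L Z by rewrite -sub0r cliftB// clift0 sub0r.
by rewrite -[Y in LHS]opprK cliftB// N opprK.
Qed.

Lemma vliftD X Y : vlift L (X + Y) = vlift L X + vlift L Y.
Proof. by rewrite -[Y in LHS]opprK vliftB// vliftN opprK. Qed.

Lemma vlift_ksign k X : vlift L (ksign k *: X) = ksign k *: vlift L X.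
Proof.
rewrite !ksignE; case: odd; last by rewrite !expr0 !scale1r.
by rewrite !expr1 !scaleN1r vliftN.
Qed.

End OnOpen.

Variables (V : set M) (A : finType) (p : A -> int) (X : A -> sect E V).
Variables (c : A -> A -> A -> fn M V).
Hypotheses (frX : frame p X) (hc : forall a a' g, hdeg (p a + p a' - p g) (c a a' g)).
Hypothesis brX : forall a a', bracket b (X a) (X a') = \sum_g c a a' g *: X g.

(** The structure functions of the frame formed by the [X_a^C] and [- X_a^V].
    The differentials come from the rule for the complete lift of [f X], and
    the sign [ksign (p a')] from skew symmetry, vertical lifts having degree
    one less. *)
Definition lift_structure (i j g : A + A) : fn TM (tM @^-1` V) :=
  match i, j, g with
  | inl a, inl a', inl g => pull tM (c a a' g)
  | inl a, inl a', inr g => - (ksign (p a + p a') * dR tM (pull tM (c a a' g)))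
  | inl a, inr a', inr g => pull tM (c a a' g)
  | inr a, inl a', inr g => ksign (p a') * pull tM (c a a' g)
  | _, _, _ => 0
  end.

Let oV : open V := fr_open frX.
Let oT : open (tM @^-1` V) := open_pre tM oV.

Lemma clift_bracket a a' : clift L (bracket b (X a) (X a')) =
  \sum_g pull tM (c a a' g) *: clift L (X g) +
  \sum_g (ksign (p a + p a') * dR tM (pull tM (c a a' g))) *: vlift L (X g).
Proof.
rewrite brX (big_morph _ (cliftD oV) (clift0 oV)) -big_split /=.
apply: eq_bigr => g _; rewrite (cliftZ _ oV (hc a a' g) (fr_deg frX g)).
by rewrite (addrC (p g)) subrK.
Qed.

Lemma vlift_bracket a a' : vlift L (bracket b (X a) (X a')) =
  \sum_g pull tM (c a a' g) *: vlift L (X g).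
Proof.
rewrite brX (big_morph _ (vliftD oV) (vlift0 oV)).
by apply: eq_bigr => g _; rewrite vliftZ.
Qed.

Lemma lift_fam_bracket i j : bracket b' (lift_fam L X i) (lift_fam L X j) =
  \sum_g lift_structure i j g *: lift_fam L X g.
Proof.
rewrite big_sumType /=; case: i j => a [] a' /=.
- rewrite (lb_cc lb)// clift_bracket; congr (_ + _).
  by apply: eq_bigr => g _; rewrite scaleNr scalerN opprK.
- rewrite bracketNr// (lb_cv lb)// vlift_bracket.
  rewrite [X in X + _]big1 ?add0r => [|g _]; last by rewrite scale0r.
  by rewrite -sumrN; apply: eq_bigr => g _; rewrite scalerN.
- rewrite bracketNl//.
  rewrite (bracket_skew b' oT (vlift_deg L oV (fr_deg frX a)) (clift_deg L oV (fr_deg frX a'))).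
  rewrite (lb_cv lb)// (bracket_skew b oV (fr_deg frX a') (fr_deg frX a)).
  rewrite vliftN// vlift_ksign// vlift_bracket !(scalerN, opprK) scalerA -ksignD.
  rewrite [X in _ = X + _]big1 ?add0r => [|g _]; last by rewrite scale0r.
  rewrite scaler_sumr -sumrN; apply: eq_bigr => g _.
  rewrite scalerN scalerA; congr (- (_ * _ *: _)).
  have -> : (p a - 1) * p a' + p a' * p a = p a * p a' + p a * p a' - p a' by ring.
  by rewrite !ksignD ksign_sq mul1r !ksignE abszN.
- rewrite bracketNl// bracketNr// (lb_vv lb)// !oppr0.
  by rewrite !big1 ?addr0// => g _; rewrite scale0r.
Qed.

End Lifted.

(** * Comparison of the two vector fields *)

Lemma res_inj (R : realType) (N : supermanifold R) (U V : set N) (f g : fn N U) :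
  open U -> U = V -> res U V f = res U V g -> f = g.
Proof. by move=> oU <-; rewrite !res_id. Qed.

Section Main.
Variables (R : realType) (M : supermanifold R) (E : vbundle M).
Variables (rho : anchored_bracket E).
Variables (A1 : supermanifold R) (tA1 : total_space 1 E A1).
Variables (TM : supermanifold R) (oM : odd_tangent M TM).
Variables (B : vbundle TM) (L : lifts E oM B).
Variables (P : supermanifold R) (oA1 : odd_tangent A1 P) (tP : total_space 1 B P).
Hypothesis hP : double_bundle tA1 oA1 L tP.
Variables (rho' : anchored_bracket B).
Hypothesis hrho' : lifted_bracket rho L rho'.
Variables (dA : operator A1) (dTA : operator P).
Hypotheses (hdA : associated_vfield rho tA1 dA).
Hypotheses (hdTA : associated_vfield rho' tP dTA).

Lemma Lie_dA_vfield : vfield setT 1 (Lie oA1 1 dA).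
Proof. exact: (Lie_vfield oA1 hdA.1). Qed.

Section Local.
Variables (V : set M) (I : finType) (deg : I -> int) (x : I -> fn M V).
Variables (A : finType) (p : A -> int) (X : A -> sect E V).
Variables (c : A -> A -> A -> fn M V).
Hypotheses (chx : chart deg x) (frX : frame p X).
Hypothesis hc : forall a a' g, hdeg (p a + p a' - p g) (c a a' g).
Hypothesis brX : forall a a', bracket rho (X a) (X a') = \sum_g c a a' g *: X g.

Let oV : open V := fr_open frX.
Let oVM : open (oM @^-1` V) := open_pre oM oV.
Let oVA : open (tA1 @^-1` V) := open_pre tA1 oV.

(** The part of [P] over [V], seen over the odd tangent bundle of the base and
    over the shifted algebroid. The two sets are equal but not convertible, so
    sections are compared after the restriction [r] from [T] to [S]. *)
Let T := tP @^-1` (oM @^-1` V).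
Let S := oA1 @^-1` (tA1 @^-1` V).
Let oT : open T := open_pre tP oVM.
Let oS : open S := open_pre oA1 oVA.

Let TS : T = S.
Proof. by apply/seteqP; split=> q; rewrite /T /S /= (db_body hP). Qed.

Let iTS : open_in T S.
Proof. by split=> //; rewrite TS. Qed.

Let F (f : fn M V) : fn P S := pull oA1 (pull tA1 f).
Let l (a : A) : fn P S := pull oA1 (tcoord tA1 X a).
Let d (u : fn P S) : fn P S := dR oA1 u.
Let r : fn P T -> fn P S := res T S.

Let lie (u : fn P S) : fn P S := Lie oA1 1 dA u.

Let dx := sum_fam (fun i => pull oM (x i)) (fun i => dR oM (pull oM (x i))).
Let ddeg := sum_fam deg (fun i => deg i + 1).
Let pL := sum_fam p (fun a => p a - 1).

Let chdx : exists kap ev, chart_on ddeg dx kap ev.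
Proof.
have [kap [ev C]] := chx; have [kap' [ev' [C' _ _]]] := dR_chart oM chx C.
by exists kap', ev'.
Qed.

Let frL : frame pL (lift_fam L X).
Proof. exact: lift_frame. Qed.

Let brL i j : bracket rho' (lift_fam L X i) (lift_fam L X j) =
  \sum_g lift_structure oM p c i j g *: lift_fam L X g.
Proof. exact: (lift_fam_bracket hrho' frX hc brX). Qed.

Let rF f : r (pull tP (pull oM f)) = F f.
Proof. exact: (db_fn hP). Qed.

Let rdF f : r (pull tP (dR oM (pull oM f))) = d (F f).
Proof. exact: (db_dfn hP). Qed.

Let rl a : r (tcoord tP (lift_fam L X) (inl a)) = l a.
Proof. exact: (db_clift hP _ frX). Qed.

Let rdl a : r (tcoord tP (lift_fam L X) (inr a)) = d (l a).
Proof. exact: (db_vlift hP _ frX). Qed.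

Let ldeg a : hdeg (1 - p a) (l a).
Proof. by apply: pull_deg => //; exact: (tcoord_deg tA1 _ frX). Qed.

Let dN u : d (- u) = - d u.
Proof. exact: (vfN (dR_vfield oA1) (open_inT oS)). Qed.

Let d_sum (J : Type) (s : seq J) (G : J -> fn P S) :
  d (\sum_(j <- s) G j) = \sum_(j <- s) d (G j).
Proof. exact: (vf_sum (dR_vfield oA1) (open_inT oS)). Qed.

Let dM k u v : hdeg k u -> d (u * v) = d u * v + ksign k * (u * d v).
Proof.
by move=> uk; rewrite /d (vf_leibniz (dR_vfield oA1) _ (open_inT oS) uk) mul1r.
Qed.

Let r_sum (J : Type) (s : seq J) (G : J -> fn P T) :
  r (\sum_(j <- s) G j) = \sum_(j <- s) r (G j).
Proof. exact: res_sum. Qed.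

Let rM u v : r (u * v) = r u * r v.
Proof. exact: resM. Qed.

Let rN u : r (- u) = - r u.
Proof. exact: resN. Qed.

Let r0 : r 0 = 0.
Proof. exact: res0. Qed.

Let r_ksign k u : r (ksign k * u) = ksign k * r u.
Proof. exact: res_ksign. Qed.

Let r_cst z : r (cst T z) = cst S z.
Proof. exact: res_cst. Qed.

Let lie_pull (y : fn A1 (tA1 @^-1` V)) : lie (pull oA1 y) = pull oA1 (dA y).
Proof. exact: (Lie_pull oA1 hdA.1 _ (open_inT oVA)). Qed.

Let lie_dpull (y : fn A1 (tA1 @^-1` V)) :
  lie (d (pull oA1 y)) = - d (pull oA1 (dA y)).
Proof.
by rewrite /lie /d (Lie_dR_pull oA1 hdA.1 _ (open_inT oVA)) subrr ksign0 mul1r.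
Qed.

Let dA_base i : pull oA1 (dA (pull tA1 (x i))) =
  \sum_a l a * F (anchor rho (X a) V (x i)).
Proof.
rewrite (associated_base hdA chx frX brX) pull_sum//.
by apply: eq_bigr => a _; rewrite pullM.
Qed.

Let dA_fibre g : pull oA1 (dA (tcoord tA1 X g)) =
  - \sum_a \sum_a' ksign (p a * (p a' - 1)) *
      (cst _ 2^-1 * (l a * l a' * F (c a a' g))).
Proof.
rewrite (associated_fibre hdA chx frX brX) pullN// pull_sum//; congr (- _).
apply: eq_bigr => a _; rewrite pull_sum//; apply: eq_bigr => a' _.
by rewrite pull_ksign// !pullM// pull_cst.
Qed.

Let dTA_base i : r (dTA (pull tP (dx i))) =
  \sum_a l a * r (pull tP (anchor rho' (clift L (X a)) _ (dx i))) -
  \sum_a d (l a) * r (pull tP (anchor rho' (vlift L (X a)) _ (dx i))).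
Proof.
rewrite (associated_base hdTA chdx frL brL) r_sum big_sumType /= -sumrN.
congr (_ + _); apply: eq_bigr => a _; rewrite rM ?rl ?rdl//.
rewrite anchorN//; last exact: open_in_refl.
by rewrite pullN// rN mulrN.
Qed.

Let aX a : vfield V (p a) (anchor rho (X a)).
Proof. by apply: anchor_vfield => //; exact: (fr_deg frX). Qed.

Let anchor_clift a y : anchor rho' (clift L (X a)) (oM @^-1` V) y =
  Lie oM (p a) (anchor rho (X a)) y.
Proof.
apply: (lb_anchor_c hrho') => //; first exact: (fr_deg frX).
exact: open_in_refl.
Qed.

Let anchor_vlift a y : anchor rho' (vlift L (X a)) (oM @^-1` V) y =
  Defs.contraction oM (anchor rho (X a)) y.
Proof.
apply: (lb_anchor_v hrho') => //; first exact: (fr_deg frX).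
exact: open_in_refl.
Qed.

Let VV : open_in V V.
Proof. exact: open_in_refl. Qed.

(** On coordinates of the base only complete lifts contribute, contractions
    being zero on functions. *)
Lemma agree_x i : r (dTA (pull tP (dx (inl i)))) = lie (r (pull tP (dx (inl i)))).
Proof.
rewrite dTA_base /= rF lie_pull dA_base [X in _ - X]big1 ?subr0 => [|a _].
  apply: eq_bigr => a _; rewrite anchor_clift (Lie_pull oM (aX a) _ VV).
  by rewrite rF.
by rewrite anchor_vlift (contraction_fn oM _ (aX a) VV) pull0// r0 mulr0.
Qed.

(** The complete lifts account for the term with d(rho), the vertical ones for
    the term with dl, of the differential of [l * rho]. *)
Lemma agree_dx i : r (dTA (pull tP (dx (inr i)))) = lie (r (pull tP (dx (inr i)))).
Proof.
rewrite dTA_base /= rdF lie_dpull dA_base d_sum -!sumrN -big_split /=.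
apply: eq_bigr => a _; rewrite (dM _ (ldeg a)).
rewrite anchor_clift (Lie_dR_pull oM (aX a) _ VV).
rewrite anchor_vlift (contraction_d oM _ (aX a) VV) rF.
rewrite pullN// pull_ksign// rN r_ksign rdF.
rewrite opprD addrC mulrN; congr (- _ - _).
rewrite mulrA ksignC -mulrA; congr (_ * _).
by rewrite -opprB !ksignE abszN.
Qed.

Let half : fn P S := cst S 2^-1.

(** The bracket of two lifts has a component along complete lifts only if both
    are complete. *)
Lemma agree_l g : r (dTA (tcoord tP (lift_fam L X) (inl g))) =
  lie (r (tcoord tP (lift_fam L X) (inl g))).
Proof.
rewrite rl lie_pull dA_fibre (associated_fibre hdTA chdx frL brL) rN r_sum.
congr (- _); rewrite big_sumType /= [X in _ + X]big1 ?addr0 => [|a _]; last first.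
  rewrite r_sum big1// => a' _; rewrite r_ksign !rM.
  by case: a' => a' /=; rewrite pull0// r0 !mulr0.
apply: eq_bigr => a _; rewrite r_sum big_sumType /= [X in _ + X]big1 ?addr0.
  apply: eq_bigr => a' _; rewrite r_ksign !rM r_cst.
  by rewrite !rl rF.
by move=> a' _; rewrite pull0// r_ksign !mulr0 r0 mulr0.
Qed.

(** The three summands of d(l l' c) match the three kinds of brackets of lifts,
    sign by sign. *)
Lemma agree_dl g : r (dTA (tcoord tP (lift_fam L X) (inr g))) =
  lie (r (tcoord tP (lift_fam L X) (inr g))).
Proof.
rewrite rdl lie_dpull dA_fibre dN opprK d_sum.
rewrite (associated_fibre hdTA chdx frL brL) rN r_sum big_sumType /=.
rewrite -big_split -sumrN; apply: eq_bigr => a _.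
rewrite !r_sum !big_sumType /= d_sum -!big_split -sumrN /=.
apply: eq_bigr => a' _.
rewrite !r_ksign !rM !r_cst -/half !(rl, rdl) !pullN// !pull_ksign//.
rewrite !pull0// !rN !r_ksign !(rF, rdF) r0 !mulr0 addr0.
have d_half u : d (half * u) = half * d u.
  exact: (vf_cstM (dR_vfield oA1) (open_inT oS)).
have d_ksign k u : d (ksign k * u) = ksign k * d u.
  exact: (vf_ksign (dR_vfield oA1) (open_inT oS)).
rewrite d_ksign d_half (dM _ (hdegM oS (ldeg a) (ldeg a'))) (dM _ (ldeg a)).
(* The terms [l a * l a' * d c], [l a * d (l a') * c], [d (l a) * l a' * c]
   come from the brackets of two complete lifts, of a complete and a vertical
   one, and of a vertical and a complete one; the Leibniz rule for [d] lists
   them in the opposite order. *)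
have rev (u v w : fn P S) : - (u + v + w) = - w - v - u.
  by rewrite !opprD addrC [- u - v]addrC addrA.
have odd1 (k : int) : odd `|(k - 1)%R|%N = ~~ odd `|k|%N by lia.
have odd1' (k : int) : odd `|(1 - k)%R|%N = ~~ odd `|k|%N by lia.
rewrite !ksignE !(odd_absD (1 - _), odd_absD (p a)) !(odd_absM, odd1, odd1').
rewrite rev [in RHS]mulrDl !mulrDr.
by congr (_ + _ + _); case: (odd `|p a|%N); case: (odd `|p a'|%N);
  rewrite /= ?(expr0, expr1, mulN1r, mul1r, mulr1, mulrN, mulNr, opprK, mulrA).
Qed.

Lemma local_comparison U (u : fn P U) : open_in T U -> dTA u = Lie oA1 1 dA u.
Proof.
have [kap [ev C]] := chdx.
have [kap' [ev' [C' _ _]]] := tcoord_chart tP frL chdx C.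
move=> TU; have oP : open_in setT T by exact: open_inT.
apply: (vfield_unique C' (vfieldW hdTA.1 oP) (vfieldW Lie_dA_vfield oP)) => // j.
apply: (@res_inj _ _ _ S) => //; rewrite (vf_res Lie_dA_vfield)//.
case: j => [[i|i]|[g|g]].
- exact: agree_x.
- exact: agree_dx.
- exact: agree_l.
- exact: agree_dl.
Qed.

End Local.

(** The structure functions are chosen homogeneous, as the rule for complete
    lifts of products asks for. *)
Lemma dTA_is_Lie U (u : fn P U) : open U -> dTA u = Lie oA1 1 dA u.
Proof.
move=> oU; apply/eqP; rewrite -subr_eq0; apply/eqP.
have D := vfield_sub hdTA.1 Lie_dA_vfield.
apply: fn_eq0 => // q Uq; pose m := oM (tP q).
have [V1 [A [p [X [V1m frX]]]]] := vb_frames E m.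
have [V2 [I [deg [x [V2m [kap [ev C]]]]]]] := sm_charts m.
have oV1 := fr_open frX; have oV2 := ch_open C.
pose V := V1 `&` V2; have oV : open V by exact: openI.
have V1V : open_in V1 V by split=> // z [].
have V2V : open_in V2 V by split=> // z [].
have frV := frame_restrict V1V frX.
have chV : chart deg (fun i => res V2 V (x i)).
  by exists kap, ev; exact: chart_restrict.
have oT : open (tP @^-1` (oM @^-1` V)) by do 2!apply: open_pre.
pose W := U `&` tP @^-1` (oM @^-1` V).
have UW : open_in U W by split; [exact: openI | move=> z []].
exists W; split=> //.
rewrite (vf_res D _ (open_inT oU) UW).
apply/eqP; rewrite subr_eq0; apply/eqP.
have cE (aa : A * A) : exists g : A -> fn M V,
    (forall b, hdeg (p aa.1 + p aa.2 - p b) (g b)) /\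
    bracket rho (sres V1 V (X aa.1)) (sres V1 V (X aa.2)) =
      \sum_b g b *: sres V1 V (X b).
  apply: homogeneous_coefficients => //.
  by apply: bracket_deg => //; exact: (fr_deg frV).
have [c cP] := choice cE.
apply: (local_comparison chV frV (c := fun a a' => c (a, a'))).
- by move=> a a' g; exact: (cP (a, a')).1.
- by move=> a a'; exact: (cP (a, a')).2.
- by split; [exact: openI | move=> z []].
Qed.

End Main.

Theorem theorem5p7 (R : realType) (M : supermanifold R)
  (E : vbundle M) (rho : algebroid E)
  (A : supermanifold R) (tA : total_space 0 E A)
  (A1 : supermanifold R) (tA1 : total_space 1 E A1)
  (TM : supermanifold R) (oM : odd_tangent M TM)
  (TA : supermanifold R) (oA : odd_tangent A TA)
  (B : vbundle TM) (L : lifts E oM B)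
  (tTA : total_space 0 B TA)
  (hTA : double_bundle tA oA L tTA)
  (P : supermanifold R) (oA1 : odd_tangent A1 P) (tP : total_space 1 B P)
  (hP : double_bundle tA1 oA1 L tP)
  (rho' : anchored_bracket B) (hrho' : lifted_bracket rho L rho')
  (dA : operator A1) (hdA : associated_vfield rho tA1 dA)
  (dTA : operator P) (hdTA : associated_vfield rho' tP dTA) :
  forall (U : set P) (F : fn P U), open U -> dTA U F = Lie oA1 1 dA F.
Proof. by move=> U F; exact: (dTA_is_Lie hP hrho' hdA hdTA). Qed.
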